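(* Let $s\geq1$ and $r\geq0$ be real numbers. The log-majorization \[ A^{r+s}B^s\succ_{\log}A^r(A^{1/2}BA^{1/2})^s \] holds for all positive semidefinite complex matrices $A,B$ of the same size in all finite dimensions if and only if either \[ 1\leq s\leq2, \] or \[ s>2\quad\text{and}\quad 0\leq r\leq\frac{s}{s-2}. \] Consequently, the trace inequality \[ \operatorname{Tr}A^{r+s}B^s\geq\operatorname{Tr}A^r(A^{1/2}BA^{1/2})^s \] holds universally (for all positive semidefinite $A,B$ in all finite dimensions) in exactly the same parameter range.
   Context: Powers of positive semidefinite matrices are taken by the functional calculus. For an $n\times n$ complex matrix $X$ with nonnegative real eigenvalues, $\lambda_1(X)\geq\cdots\geq\lambda_n(X)\geq0$ denote its eigenvalues counted with multiplicity. For two such matrices, $X\succ_{\log}Y$ means \[ \prod_{j=1}^k\lambda_j(Y)\leq\prod_{j=1}^k\lambda_j(X)\quad(1\leq k<n),\qquad \det X=\det Y . \] The products $A^{r+s}B^s$ and $A^r(A^{1/2}BA^{1/2})^s$ need not be Hermitian, but they have nonnegative real eigenvalues, and the log-majorization is understood in terms of these eigenvalues. *)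

(* Defs.v *)
From HB Require Import structures.
From mathcomp Require Import all_boot all_order all_algebra.
From mathcomp Require Import complex.
From mathcomp Require Import reals exp.

Set Implicit Arguments.
Unset Strict Implicit.
Unset Printing Implicit Defensive.

Import Order.TTheory GRing.Theory Num.Theory.
Local Open Scope ring_scope.
Local Open Scope sesquilinear_scope.

Section Spectrum.
Variable C : numClosedFieldType.

Definition psdmx n (A : 'M[C]_n) : Prop :=
  A \is hermsymmx /\ forall x : 'cV[C]_n, 0 <= (x ^t* *m A *m x) 0 0.

(* Functional calculus for a normal matrix [A = P^-1 *m diag_mx d *m P], with
   [P] unitary; the value does not depend on the chosen diagonalization. *)
Definition mxfun n (f : C -> C) (A : 'M[C]_n) : 'M[C]_n :=
  let P := spectralmx A in
  invmx P *m diag_mx (map_mx f (spectral_diag A)) *m P.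

(* The roots of the characteristic polynomial, with multiplicity. The order on
   [C] is partial, but total on the nonnegative reals: the sequence is
   nonincreasing as soon as all the eigenvalues are nonnegative reals. *)
Definition eigenvalues n (X : 'M[C]_n) : seq C :=
  sort (fun x y : C => y <= x)
    (sval (closed_field_poly_normal (char_poly X))).

(* Indices start at 0: [(eigenvalues X)`_j] is the (j+1)-st eigenvalue.
   Meaningful when both spectra are nonnegative reals, as for products of two
   positive semidefinite matrices ([eigenvalues_psdM_ge0] below). *)
Definition log_majorizes n (X Y : 'M[C]_n) : Prop :=
  (forall k, (1 <= k < n)%N ->
     \prod_(j < k) (eigenvalues Y)`_j <= \prod_(j < k) (eigenvalues X)`_j) /\
  \det X = \det Y.

Lemma char_poly_eigenvalues n (X : 'M[C]_n) :
  char_poly X = \prod_(z <- eigenvalues X) ('X - z%:P).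
Proof.
rewrite /eigenvalues; case: closed_field_poly_normal => s /= Hs.
rewrite {1}Hs (monicP (char_poly_monic X)) scale1r.
by apply: perm_big; rewrite perm_sym perm_sort.
Qed.

Lemma size_eigenvalues n (X : 'M[C]_n) : size (eigenvalues X) = n.
Proof.
apply: succn_inj; rewrite -(size_char_poly X) char_poly_eigenvalues.
by rewrite size_prod_XsubC.
Qed.

Lemma mem_eigenvalues n (X : 'M[C]_n) a :
  (a \in eigenvalues X) = eigenvalue X a.
Proof.
by rewrite eigenvalue_root_char char_poly_eigenvalues root_prod_XsubC.
Qed.

Lemma sorted_eigenvalues n (X : 'M[C]_n) :
  {in eigenvalues X, forall z, 0 <= z} ->
  sorted (fun x y : C => y <= x) (eigenvalues X).
Proof.
move=> Xge0; apply: (@sort_sorted_in _ [pred z : C | 0 <= z]) => [x y|].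
  rewrite !inE => x0 y0.
  by rewrite orbC real_leVge ?ger0_real.
by apply/allP => z zX; apply: Xge0; rewrite /eigenvalues mem_sort.
Qed.

Lemma psdmx_spectral n (A : 'M[C]_n) : psdmx A ->
  A = invmx (spectralmx A) *m diag_mx (spectral_diag A) *m spectralmx A.
Proof. by case=> /hermitian_normalmx/orthomx_spectralP. Qed.

Lemma psdmx_spectral_diag_ge0 n (A : 'M[C]_n) i : psdmx A ->
  0 <= spectral_diag A 0 i.
Proof.
move=> pA; have eA := psdmx_spectral pA; case: pA => _ Apos.
set P := spectralmx A in eA; have uP : P \is unitarymx by exact: spectral_unitarymx.
have := Apos (P ^t* *m delta_mx i 0).
rewrite {1}eA invmx_unitary // trmx_mul map_mxM trmxCK !mulmxA.
rewrite !(mulmxtVK _ _) // -!mulmxA mulmxA.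
suff -> : (delta_mx i 0 : 'cV[C]_n) ^t* = delta_mx 0 i.
  by rewrite -rowE -colE !mxE eqxx mulr1n.
by apply/matrixP => a b; rewrite !mxE [LHS]rmorph_nat andbC.
Qed.

Lemma psdmx_gram n (S : 'M[C]_n) : psdmx (S *m S ^t*).
Proof.
split=> [|x].
  by rewrite is_hermitianmxE expr0 scale1r trmx_mul map_mxM trmxCK.
rewrite mulmxA -mulmxA -[X in X *m _]trmxCK trmx_mul map_mxM trmxCK mxE.
by apply: sumr_ge0 => j _; rewrite !mxE mulrC mul_conjC_ge0.
Qed.

Lemma psdmx_conj n (S B : 'M[C]_n) : psdmx B -> psdmx (S ^t* *m B *m S).
Proof.
move=> [/is_hermitianmxP Bh Bpos]; rewrite expr0 scale1r in Bh; split=> [|x].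
  by rewrite is_hermitianmxE expr0 scale1r !trmx_mul !map_mxM trmxCK -Bh mulmxA.
by have := Bpos (S *m x); rewrite trmx_mul map_mxM !mulmxA.
Qed.

Lemma eq_mxfun n (f g : C -> C) (A : 'M[C]_n) :
  (forall i, f (spectral_diag A 0 i) = g (spectral_diag A 0 i)) ->
  mxfun f A = mxfun g A.
Proof.
move=> fg; rewrite /mxfun; congr (_ *m diag_mx _ *m _).
by apply/rowP => i; rewrite !mxE.
Qed.

Lemma mxfun_id n (A : 'M[C]_n) : psdmx A -> mxfun id A = A.
Proof.
move=> pA; rewrite {2}(psdmx_spectral pA) /mxfun.
by congr (_ *m diag_mx _ *m _); apply/rowP => i; rewrite !mxE.
Qed.

Lemma mxfun1 n (A : 'M[C]_n) : mxfun (fun=> 1) A = 1%:M.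
Proof.
rewrite /mxfun (_ : map_mx _ _ = const_mx 1).
  by rewrite diag_const_mx mulmx1 mulVmx // spectral_unit.
by apply/rowP => i; rewrite !mxE.
Qed.

Lemma mxfunM n (f g : C -> C) (A : 'M[C]_n) :
  mxfun f A *m mxfun g A = mxfun (fun z => f z * g z) A.
Proof.
rewrite /mxfun !mulmxA mulmxK ?spectral_unit //.
rewrite -(mulmxA (invmx _) (diag_mx _)) mulmx_diag.
by congr (_ *m diag_mx _ *m _); apply/rowP => i; rewrite !mxE.
Qed.

Lemma mxfun_herm n (f : C -> C) (A : 'M[C]_n) :
  (forall z, f z \is Num.real) -> (mxfun f A) ^t* = mxfun f A.
Proof.
move=> fr; rewrite /mxfun invmx_unitary ?spectral_unitarymx //.
rewrite !trmx_mul !map_mxM trmxCK mulmxA tr_diag_mx map_diag_mx.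
congr (_ *m diag_mx _ *m _); apply/rowP => i; rewrite !mxE.
exact: conj_Creal.
Qed.

Lemma mxfun_psd n (f : C -> C) (A : 'M[C]_n) :
  (forall z, 0 <= f z) -> psdmx (mxfun f A).
Proof.
move=> f0; pose g z := sqrtC (f z).
have gr z : g z \is Num.real by rewrite ger0_real // sqrtC_ge0.
have := psdmx_gram (mxfun g A); rewrite (mxfun_herm _ gr) mxfunM.
rewrite (@eq_mxfun _ _ f) // => i.
by rewrite -expr2 sqrtCK.
Qed.

Lemma eigenvalues_gram_ge0 n (S B : 'M[C]_n) : S ^t* = S -> psdmx B ->
  {in eigenvalues (S *m S *m B), forall z, 0 <= z}.
Proof.
move=> Sh pB a; rewrite mem_eigenvalues => /eigenvalueP[v vAB v0].
have [-> //|a0] := eqVneq a 0.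
pose u := v *m S.
have u0 : u != 0.
  apply: contra_neq v0 => u0; have : a *: v = 0.
    by rewrite -vAB !mulmxA -/u u0 !mul0mx.
  by move/eqP; rewrite scaler_eq0 (negPf a0) => /eqP.
have uE : u *m (S ^t* *m B *m S) = a *: u.
  by rewrite Sh scalemxAl -vAB !mulmxA.
have [_ /(_ (u ^t* ))] := psdmx_conj S pB.
rewrite trmxCK uE -scalemxAl mxE => au.
have uj0 j : true -> 0 <= u 0 j * u ^t* j 0.
  by rewrite !mxE mul_conjC_ge0.
suff u2 : 0 < (u *m u ^t* ) 0 0 by rewrite -(pmulr_lge0 _ u2).
have u2 : 0 <= (u *m u ^t* ) 0 0 by rewrite mxE; apply: sumr_ge0.
rewrite lt_def u2 andbT; apply: contra_neq u0.
rewrite mxE => u_eq0; apply/rowP => j; rewrite mxE.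
have /eqP : u 0 j * u ^t* j 0 = 0 by exact: (psumr_eq0P uj0 u_eq0).
by rewrite !mxE mul_conjC_eq0 => /eqP.
Qed.

End Spectrum.

Section Power.
Variable R : realType.
Local Notation C := R[i].

(* The spectrum of a positive semidefinite matrix lies in the nonnegative
   reals. As [0 `^ 0 = 1], [mxpow A 0] is the identity, also when [A] is
   singular. *)
Definition mxpow n (A : 'M[C]_n) (t : R) : 'M[C]_n :=
  mxfun (fun z : C => ((complex.Re z) `^ t)%:C%C) A.

Lemma mxpow0 n (A : 'M[C]_n) : mxpow A 0 = 1%:M.
Proof.
rewrite -(mxfun1 A); apply: eq_mxfun => i.
by rewrite powRr0.
Qed.

Lemma mxpow1 n (A : 'M[C]_n) : psdmx A -> mxpow A 1 = A.
Proof.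
move=> pA; apply: etrans (mxfun_id pA); apply: eq_mxfun => i.
move: (psdmx_spectral_diag_ge0 i pA); case: (spectral_diag A 0 i) => x y.
by rewrite lecE => /andP[/= /eqP -> x0]; rewrite powRr1.
Qed.

Lemma mxpowD n (A : 'M[C]_n) t u : 0 < t -> 0 < u ->
  mxpow A t *m mxpow A u = mxpow A (t + u).
Proof.
move=> t0 u0; apply: etrans (mxfunM _ _ _) _; apply: eq_mxfun => i.
by rewrite -rmorphM /= powRD // gt_eqF // addr_gt0.
Qed.

Lemma mxpow_ge0 t (z : C) : 0 <= (((complex.Re z) `^ t)%:C%C : C).
Proof. by rewrite ler0c powR_ge0. Qed.

Lemma mxpow_herm n (A : 'M[C]_n) t : (mxpow A t) ^t* = mxpow A t.
Proof. by apply: mxfun_herm => z; apply/ger0_real/mxpow_ge0. Qed.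

Lemma mxpow_psd n (A : 'M[C]_n) t : psdmx (mxpow A t).
Proof. by apply: mxfun_psd => z; apply: mxpow_ge0. Qed.

Lemma eigenvalues_psdM_ge0 n (A B : 'M[C]_n) : psdmx A -> psdmx B ->
  {in eigenvalues (A *m B), forall z, 0 <= z}.
Proof.
move=> pA pB.
have e : mxpow A (2^-1) *m mxpow A (2^-1) = A.
  rewrite mxpowD ?invr_gt0 ?ltr0n // (_ : _ + _ = 1) ?mxpow1 //.
  by rewrite -mulr2n -[LHS]mulr_natl mulfV // pnatr_eq0.
have := @eigenvalues_gram_ge0 _ _ (mxpow A (2^-1)) B (mxpow_herm _ _) pB.
by rewrite e.
Qed.

End Power.

(* Main.v *)
Require Import Defs.
From HB Require Import structures.
From mathcomp Require Import all_boot all_order all_algebra.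
From mathcomp Require Import fingroup perm.
From mathcomp Require Import complex.
From mathcomp Require Import reals exp.
From mathcomp Require Import ring lra.

(* Exterior powers commute with products and with powers of positive
   semidefinite matrices, and turn products of the k largest eigenvalues into
   largest eigenvalues; so log-majorization reduces to the case k = 1. By
   homogeneity in B this is: if B^s <= A^-(r+s) then D^s <= A^-r, where
   D = A^(1/2) B A^(1/2). More generally D^t <= A^-(rt/s) for 0 <= t <= s, as
   long as t <= 2 or r(t-2) <= s: for t <= 1 it follows from Loewner-Heinz, for
   1 <= t <= 2 one applies Loewner-Heinz to
   D^t = A^(1/2) B^(1/2) (B^(1/2) A B^(1/2))^(t-1) B^(1/2) A^(1/2), and for t > 2
   the bound on D^(t-2) carries over to D^t = D D^(t-2) D, the restriction on r
   being what keeps the exponent 1 - r(t-2)/s nonnegative. An inequality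
   X <= Y^-1 is read as "the spectrum of X Y is at most 1", which makes sense for
   singular matrices and is preserved by powers in [0, 1] (Cordes).

   Log-majorization implies the trace inequality, by Abel summation of
   x - y >= y ln (x / y). Conversely, when s > 2 and r > s / (s - 2), the trace
   inequality fails for 3 x 3 matrices A = diag(1, b, 0) with b small. *)

Set Implicit Arguments.
Unset Strict Implicit.
Unset Printing Implicit Defensive.

Import Order.TTheory GRing.Theory Num.Theory.
Local Open Scope ring_scope.
Local Open Scope sesquilinear_scope.

(** * Positive semidefinite matrices and bounds on spectra *)

Section PsdOrder.
Variable C : numClosedFieldType.

Lemma adjmxM m n p (A : 'M[C]_(m, n)) (B : 'M_(n, p)) :
  (A *m B) ^t* = B ^t* *m A ^t*.
Proof. by rewrite trmx_mul map_mxM. Qed.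

Lemma adjmxB m n (A B : 'M[C]_(m, n)) : (A - B) ^t* = A ^t* - B ^t*.
Proof. by rewrite linearB map_mxB. Qed.

Lemma adjmx_scalar n (a : C) : (a%:M : 'M_n) ^t* = (a^*)%:M.
Proof. by rewrite tr_scalar_mx map_scalar_mx. Qed.

Lemma psdmx_adj n (A : 'M[C]_n) : psdmx A -> A ^t* = A.
Proof. by case=> /is_hermitianmxP; rewrite expr0 scale1r => <-. Qed.

Lemma psdmxP n (A : 'M[C]_n) :
  A ^t* = A -> (forall x : 'cV_n, 0 <= (x ^t* *m A *m x) 0 0) -> psdmx A.
Proof. by move=> Ah A0; split=> //; rewrite is_hermitianmxE expr0 scale1r Ah. Qed.

Lemma psdmx0 n : psdmx (0 : 'M[C]_n).
Proof.
apply: psdmxP => [|x]; first by rewrite trmx0 map_mx0.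
by rewrite mulmx0 mul0mx mxE.
Qed.

Lemma psdmxD n (A B : 'M[C]_n) : psdmx A -> psdmx B -> psdmx (A + B).
Proof.
move=> pA pB; apply: psdmxP => [|x].
  by rewrite linearD map_mxD !psdmx_adj.
by rewrite mulmxDr mulmxDl mxE addr_ge0 //; [case: pA|case: pB].
Qed.

Lemma psdmxZ n (a : C) (A : 'M_n) : 0 <= a -> psdmx A -> psdmx (a *: A).
Proof.
move=> a0 pA; apply: psdmxP => [|x].
  by rewrite linearZ map_mxZ /= conj_Creal ?ger0_real // psdmx_adj.
by rewrite -scalemxAr -scalemxAl mxE mulr_ge0 //; case: pA.
Qed.

Lemma psdmx_congr m n (S : 'M[C]_(m, n)) (B : 'M_m) :
  psdmx B -> psdmx (S ^t* *m B *m S).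
Proof.
move=> pB; apply: psdmxP => [|x].
  by rewrite !adjmxM trmxCK psdmx_adj // mulmxA.
by case: pB => _ /(_ (S *m x)); rewrite adjmxM !mulmxA.
Qed.

Lemma row_sqnorm_gt0 n (v : 'rV[C]_n) : v != 0 -> 0 < (v *m v ^t*) 0 0.
Proof.
move=> v0; have vj j : true -> 0 <= v 0 j * v ^t* j 0.
  by rewrite !mxE mul_conjC_ge0.
have vv : 0 <= (v *m v ^t*) 0 0 by rewrite mxE; apply: sumr_ge0.
rewrite lt_def vv andbT; apply: contra_neq v0.
rewrite mxE => v_eq0; apply/rowP => j; rewrite mxE.
have /eqP : v 0 j * v ^t* j 0 = 0 by exact: (psumr_eq0P vj v_eq0).
by rewrite !mxE mul_conjC_eq0 => /eqP.
Qed.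

Lemma psdmx_eigenvalue n (A : 'M[C]_n) a : psdmx A -> eigenvalue A a -> 0 <= a.
Proof.
move=> [_ pA] /eigenvalueP[v vA v0].
have := pA (v ^t*); rewrite trmxCK vA -scalemxAl mxE.
by rewrite pmulr_lge0 // row_sqnorm_gt0.
Qed.

Lemma mul_rV_eq_diag n (A : 'M[C]_n) i : A \is normalmx ->
  row i (spectralmx A) *m A = spectral_diag A 0 i *: row i (spectralmx A).
Proof.
move=> /orthomx_spectralP eA; rewrite -row_mul {2}eA !mulmxA.
rewrite mulmxV ?spectral_unit // mul1mx mul_diag_mx.
by apply/rowP => j; rewrite !mxE.
Qed.

Lemma eigenvalue_spectral_diag n (A : 'M[C]_n) i :
  A \is normalmx -> eigenvalue A (spectral_diag A 0 i).
Proof.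
move=> nA; apply/eigenvalueP; exists (row i (spectralmx A)).
  exact: mul_rV_eq_diag.
apply/eqP => r0; have /unitarymxP/matrixP/(_ i i) := spectral_unitarymx A.
rewrite mxE big1 => [|j _].
  by rewrite mxE eqxx => /esym/eqP; rewrite oner_eq0.
by move/rowP/(_ j): r0; rewrite !mxE => ->; rewrite mul0r.
Qed.

Lemma adj_normal n (A : 'M[C]_n) : A ^t* = A -> A \is normalmx.
Proof.
by move=> Ah; apply: hermitian_normalmx; rewrite is_hermitianmxE expr0 scale1r Ah.
Qed.

Lemma eigenvalue_ge0_psdmx n (A : 'M[C]_n) :
  A ^t* = A -> (forall a, eigenvalue A a -> 0 <= a) -> psdmx A.
Proof.
move=> Ah A0; have nA := adj_normal Ah.
rewrite (orthomx_spectralP nA) invmx_unitary ?spectral_unitarymx //.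
apply: psdmx_congr; apply: psdmxP => [|x].
  rewrite tr_diag_mx map_diag_mx; congr diag_mx; apply/rowP => i; rewrite mxE.
  by apply/conj_Creal/ger0_real/A0/eigenvalue_spectral_diag.
rewrite mul_mx_diag mxE; apply: sumr_ge0 => i _; rewrite !mxE mulrAC mulrC.
rewrite mulr_ge0 //; last by rewrite mulrC mul_conjC_ge0.
exact/A0/eigenvalue_spectral_diag.
Qed.

(** Multiplication by [X] carries an eigenvector of [X *m Y] to one of [Y *m X]; the image can
    vanish only when [a = 0]. *)
Lemma eigenvalue_mulC m n (X : 'M[C]_(m, n)) (Y : 'M_(n, m)) a :
  a != 0 -> eigenvalue (X *m Y) a -> eigenvalue (Y *m X) a.
Proof.
move=> a0 /eigenvalueP[v vXY v0]; apply/eigenvalueP; exists (v *m X).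
  by rewrite !mulmxA -(mulmxA v) vXY scalemxAl.
apply: contra_neq v0 => vX0; move: vXY; rewrite mulmxA vX0 mul0mx => /esym/eqP.
by rewrite scaler_eq0 (negPf a0) => /eqP.
Qed.

(** For real [M], [a <= M] in the partial order of [C] also says that [a] is real. *)
Definition spec_le (M : C) n (T : 'M[C]_n) := all (fun a => a <= M) (eigenvalues T).

Lemma spec_leP M n (T : 'M[C]_n) :
  reflect (forall a, eigenvalue T a -> a <= M) (spec_le M T).
Proof.
by apply: (iffP allP) => TM a; [rewrite -mem_eigenvalues | rewrite mem_eigenvalues];
  apply: TM.
Qed.

Lemma spec_le_mulC M m n (X : 'M[C]_(m, n)) (Y : 'M_(n, m)) : 0 <= M ->
  spec_le M (X *m Y) -> spec_le M (Y *m X).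
Proof.
move=> M0 /spec_leP XY; apply/spec_leP => a; have [->//|a0] := eqVneq a 0.
by move=> /(eigenvalue_mulC a0)/XY.
Qed.

Lemma spec_le_psd n M (H : 'M[C]_n) : M \is Num.real -> H ^t* = H ->
  spec_le M H <-> psdmx (M%:M - H).
Proof.
move=> Mr Hh; split=> [/spec_leP HM|pH].
  apply: eigenvalue_ge0_psdmx => [|a /eigenvalueP[v vH v0]].
    by rewrite adjmxB adjmx_scalar conj_Creal // Hh.
  have /HM : eigenvalue H (M - a).
    apply/eigenvalueP; exists v => //; rewrite scalerBl -vH mulmxBr.
    by rewrite mul_mx_scalar opprB addrC subrK.
  by rewrite lerBlDr lerDl.
apply/spec_leP => a /eigenvalueP[v vH v0].
rewrite -subr_ge0; apply: (psdmx_eigenvalue pH).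
by apply/eigenvalueP; exists v => //; rewrite mulmxBr mul_mx_scalar vH scalerBl.
Qed.

(** The two cyclic rearrangements share their nonzero eigenvalues, and [0 <= M] takes care of the
    eigenvalue 0. This turns bounds on the spectrum of a non-Hermitian product into Loewner
    inequalities. *)
Lemma spec_le_sandwich n M (S X : 'M[C]_n) : 0 <= M -> S ^t* = S -> psdmx X ->
  spec_le M (S *m S *m X) <-> psdmx (M%:M - S *m X *m S).
Proof.
move=> M0 Sh pX; rewrite -mulmxA.
have SXh : (S *m X *m S) ^t* = S *m X *m S.
  by rewrite !adjmxM Sh psdmx_adj // mulmxA.
have [leS Sle] := spec_le_psd (ger0_real M0) SXh.
by split=> [/(spec_le_mulC M0)/leS|/Sle/(spec_le_mulC M0)].
Qed.

Lemma psdmx_eq0 n (H : 'M[C]_n) : psdmx H -> psdmx (- H) -> H = 0.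
Proof.
move=> pH pNH; have nH := adj_normal (psdmx_adj pH).
rewrite (orthomx_spectralP nH) (_ : spectral_diag H = 0).
  by rewrite linear0 mulmx0 mul0mx.
apply/rowP => i; rewrite mxE; apply/le_anti/andP; split.
  rewrite -oppr_ge0; apply: (psdmx_eigenvalue pNH); apply/eigenvalueP.
  have /eigenvalueP[v vH v0] := eigenvalue_spectral_diag i nH.
  by exists v => //; rewrite mulmxN vH scaleNr.
exact/(psdmx_eigenvalue pH)/eigenvalue_spectral_diag.
Qed.

Lemma psdmx_le_trans n (A B D : 'M[C]_n) :
  psdmx (B - A) -> psdmx (D - B) -> psdmx (D - A).
Proof. by move=> AB BD; rewrite -(subrKA B); apply: psdmxD. Qed.

Lemma psdmx_congrB m n (S : 'M[C]_(m, n)) (A B : 'M_m) :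
  psdmx (B - A) -> psdmx (S ^t* *m B *m S - S ^t* *m A *m S).
Proof. by move/(psdmx_congr S); rewrite mulmxBr mulmxBl. Qed.

Lemma adjmx_eq0 m n (Z : 'M[C]_(m, n)) : Z ^t* *m Z = 0 -> Z = 0.
Proof.
move=> Z0; apply/matrixP => i j; rewrite mxE.
have Zk k : true -> 0 <= Z ^t* j k * Z k j by rewrite !mxE mulrC mul_conjC_ge0.
have /(psumr_eq0P Zk)/(_ i isT)/eqP : \sum_k Z ^t* j k * Z k j = 0.
  by move/matrixP/(_ j j): Z0; rewrite !mxE.
by rewrite !mxE mulrC mul_conjC_eq0 => /eqP.
Qed.

(* Contractions are closed under products, and their spectrum lies in the unit
   disk. *)
Lemma psdmx_contrM m n p (Z : 'M[C]_(m, n)) (W : 'M_(n, p)) :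
  psdmx (1%:M - Z *m Z ^t*) -> psdmx (1%:M - W *m W ^t*) ->
  psdmx (1%:M - (Z *m W) *m (Z *m W) ^t*).
Proof.
move=> pZ /(psdmx_congr (Z ^t*)); rewrite trmxCK mulmxBr mulmxBl mulmx1 => pW.
by rewrite adjmxM !mulmxA in pW *; apply: psdmx_le_trans pW pZ.
Qed.

Lemma contr_eigenvalue n (Z : 'M[C]_n) a :
  psdmx (1%:M - Z *m Z ^t*) -> eigenvalue Z a -> `|a| <= 1.
Proof.
move=> [_ pZ] /eigenvalueP[v vZ v0].
have := pZ (v ^t*); rewrite trmxCK mulmxBr mulmx1 mulmxBl mulmxA.
rewrite -(mulmxA (v *m Z)) -adjmxM vZ linearZ map_mxZ /= -scalemxAl -scalemxAr.
rewrite scalerA !mxE -[X in X - _]mul1r -mulrBl -normCK pmulr_lge0.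
  by rewrite subr_ge0 expr_le1.
by have := row_sqnorm_gt0 v0; rewrite mxE.
Qed.

(** In an eigenbasis of [A] the hypothesis reads [e_i w_ij = w_ij d_j], so [e_i = d_j] wherever
    [w_ij] is nonzero. [V] may be rectangular or singular, so the calculus can be evaluated on any
    family of eigenvectors. *)
Lemma intertwine_diag m n (A : 'M[C]_m) (V : 'M_(m, n)) (d : 'rV_n) f :
  A \is normalmx -> A *m V = V *m diag_mx d ->
  mxfun f A *m V = V *m diag_mx (map_mx f d).
Proof.
move=> nA; have := orthomx_spectralP nA; rewrite /mxfun.
set P := spectralmx A; set e := spectral_diag A => eA AV.
have uP : P \in unitmx by exact: spectral_unit.
have : diag_mx e *m (P *m V) = (P *m V) *m diag_mx d.
  by rewrite -[RHS]mulmxA -AV eA !mulmxA mulmxV // mul1mx.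
rewrite mul_diag_mx mul_mx_diag => /matrixP eW.
apply: (can_inj (mulKmx uP)); rewrite !mulmxA mulmxV // mul1mx -[LHS]mulmxA.
rewrite mul_diag_mx mul_mx_diag; apply/matrixP => i j.
have := eW i j; rewrite !mxE.
set w := \sum_k _; have [->|w0] := eqVneq w 0; first by rewrite !(mulr0, mul0r).
by rewrite mulrC => /(mulfI w0) ->; rewrite mulrC.
Qed.

Lemma intertwine m n (A : 'M[C]_m) (V : 'M_(m, n)) (B : 'M_n) f :
  A \is normalmx -> B \is normalmx -> A *m V = V *m B ->
  mxfun f A *m V = V *m mxfun f B.
Proof.
move=> nA nB AV; have := orthomx_spectralP nB.
rewrite [mxfun f B]/mxfun; set P := spectralmx B; set e := spectral_diag B => eB.
have uP : P \in unitmx by exact: spectral_unit.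
apply: (can_inj (mulmxKV uP)); rewrite !mulmxA mulmxK // -[LHS]mulmxA.
apply: intertwine_diag => //.
by rewrite mulmxA AV eB !mulmxA mulmxK.
Qed.

End PsdOrder.

(** * Powers and the Cordes inequality *)

Section Mxfun.
Variable C : numClosedFieldType.

Lemma psdmx_normal n (A : 'M[C]_n) : psdmx A -> A \is normalmx.
Proof. by move/psdmx_adj/adj_normal. Qed.

Lemma mxfun_similar n (A P : 'M[C]_n) (d : 'rV_n) f : A \is normalmx ->
  P \in unitmx -> A = invmx P *m diag_mx d *m P ->
  mxfun f A = invmx P *m diag_mx (map_mx f d) *m P.
Proof.
move=> nA uP eA; rewrite -(@intertwine_diag _ _ _ A) ?mulmxKV //.
by rewrite eA mulmxK.
Qed.

Lemma mxfunZ n c f (A : 'M[C]_n) : c *: mxfun f A = mxfun (fun z => c * f z) A.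
Proof.
rewrite /mxfun scalemxAl scalemxAr -linearZ; congr (_ *m diag_mx _ *m _).
by apply/rowP => i; rewrite !mxE.
Qed.

Lemma mxfunB n f g (A : 'M[C]_n) :
  mxfun f A - mxfun g A = mxfun (fun z => f z - g z) A.
Proof.
rewrite /mxfun -mulmxBl -mulmxBr -linearB; congr (_ *m diag_mx _ *m _).
by apply/rowP => i; rewrite !mxE.
Qed.

Lemma mxfun_ge0 n f (A : 'M[C]_n) :
  (forall i, 0 <= f (spectral_diag A 0 i)) -> psdmx (mxfun f A).
Proof.
move=> f0; have -> : mxfun f A = mxfun (fun z => `|f z|) A.
  by apply: eq_mxfun => i; rewrite ger0_norm.
exact: mxfun_psd.
Qed.

Lemma spec_leZ n M c (T : 'M[C]_n) : 0 < c -> 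
  spec_le M T -> spec_le (c * M) (c *: T).
Proof.
move=> c0 /spec_leP TM; apply/spec_leP => a /eigenvalueP[v vT v0].
have /TM : eigenvalue T (c^-1 * a).
  apply/eigenvalueP; exists v => //.
  by rewrite -scalerA -vT -scalemxAr scalerA mulVf ?gt_eqF // scale1r.
by rewrite ler_pdivrMl.
Qed.

End Mxfun.

Section Mxpow.
Variable R : realType.
Local Notation C := R[i].

Lemma mxpow_normal n (A : 'M[C]_n) t : mxpow A t \is normalmx.
Proof. exact/psdmx_normal/mxpow_psd. Qed.

Lemma mxpowDn n (A : 'M[C]_n) t u : 0 <= t -> 0 <= u ->
  mxpow A t *m mxpow A u = mxpow A (t + u).
Proof.
rewrite le_eqVlt => /predU1P[<-|t0]; first by rewrite mxpow0 mul1mx add0r.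
rewrite le_eqVlt => /predU1P[<-|u0]; first by rewrite mxpow0 mulmx1 addr0.
exact: mxpowD.
Qed.

Lemma mxpowM n (A : 'M[C]_n) t u : mxpow (mxpow A t) u = mxpow A (t * u).
Proof.
apply: etrans (mxfun_similar _ (mxpow_normal A t) (spectral_unit A) _) _.
  by rewrite /mxpow /mxfun.
congr (invmx (spectralmx A) *m diag_mx _ *m spectralmx A).
by apply/rowP => i; rewrite !mxE /= powRrM.
Qed.

Lemma mxpow_swap m n (X : 'M[C]_(m, n)) t :
  mxpow (X *m X ^t*) t *m X = X *m mxpow (X ^t* *m X) t.
Proof.
apply: intertwine; rewrite ?mulmxA //; apply: adj_normal.
  by rewrite adjmxM trmxCK.
by rewrite adjmxM trmxCK.
Qed.

Lemma mxpow_mul0 m n (A : 'M[C]_m) (V : 'M_(m, n)) t : psdmx A -> t != 0 ->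
  A *m V = 0 -> mxpow A t *m V = 0.
Proof.
move=> pA t0 AV; apply: etrans (intertwine_diag (d := 0) _ (psdmx_normal pA) _) _.
  by rewrite linear0 mulmx0.
rewrite (_ : map_mx _ _ = 0) ?linear0 ?mulmx0 //.
by apply/rowP => i; rewrite !mxE /= powR0.
Qed.

Lemma mxpowZ n (A : 'M[C]_n) c t : psdmx A -> 0 <= c ->
  mxpow (c%:C%C *: A) t = (c `^ t)%:C%C *: mxpow A t.
Proof.
move=> pA c0; have nA : c%:C%C *: A \is normalmx.
  by apply/psdmx_normal/psdmxZ => //; rewrite ler0c.
apply: etrans (mxfun_similar (d := c%:C%C *: spectral_diag A) _ nA
  (spectral_unit A) _) _.
  by rewrite {1}(psdmx_spectral pA) linearZ /= -scalemxAr -scalemxAl.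
rewrite /mxpow mxfunZ /mxfun.
congr (invmx (spectralmx A) *m diag_mx _ *m spectralmx A).
apply/rowP => i; rewrite !mxE -rmorphM /=.
move: (psdmx_spectral_diag_ge0 i pA); case: (spectral_diag A 0 i) => x y.
by rewrite lecE => /andP[/= _ x0]; rewrite mul0r subr0 powRM.
Qed.

Lemma mxpow_diag n (d : 'rV[C]_n) t : (forall i, 0 <= d 0 i) ->
  mxpow (diag_mx d) t =
  diag_mx (map_mx (fun z : C => ((complex.Re z) `^ t)%:C%C) d).
Proof.
move=> d0; have nd : diag_mx d \is normalmx.
  apply: adj_normal; rewrite tr_diag_mx map_diag_mx; congr diag_mx.
  by apply/rowP => i; rewrite mxE; apply/conj_Creal/ger0_real.
apply: etrans (mxfun_similar (d := d) _ nd (unitmx1 _ _) _) _.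
  by rewrite invmx1 mul1mx mulmx1.
by rewrite invmx1 mul1mx mulmx1.
Qed.

End Mxpow.

(* [mxpow], sealed: unification failures on products of powers must not unfold
   the functional calculus down to the construction of the real exponential. *)
HB.lock Definition psdpow (R : realType) n (A : 'M[R[i]]_n) (t : R) := mxpow A t.

Section Psdpow.
Variable R : realType.
Local Notation C := R[i].

Lemma psdpowE n (A : 'M[C]_n) t : mxpow A t = psdpow A t.
Proof. by rewrite psdpow.unlock. Qed.

Lemma psdpow_psd n (A : 'M[C]_n) t : psdmx (psdpow A t).
Proof. by rewrite -psdpowE; apply: mxpow_psd. Qed.

Lemma psdpow_adj n (A : 'M[C]_n) t : (psdpow A t) ^t* = psdpow A t.
Proof. exact/psdmx_adj/psdpow_psd. Qed.

Lemma psdpow0 n (A : 'M[C]_n) : psdpow A 0 = 1%:M.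
Proof. by rewrite -psdpowE; apply: mxpow0. Qed.

Lemma psdpow1 n (A : 'M[C]_n) : psdmx A -> psdpow A 1 = A.
Proof. by rewrite -psdpowE; apply: mxpow1. Qed.

Lemma psdpowD n (A : 'M[C]_n) t u : 0 <= t -> 0 <= u ->
  psdpow A t *m psdpow A u = psdpow A (t + u).
Proof. by rewrite -!psdpowE; apply: mxpowDn. Qed.

Lemma psdpowM n (A : 'M[C]_n) t u : psdpow (psdpow A t) u = psdpow A (t * u).
Proof. by rewrite -!psdpowE; apply: mxpowM. Qed.

Lemma psdpow_half n (A : 'M[C]_n) t : 0 <= t ->
  psdpow A (t / 2) *m psdpow A (t / 2) = psdpow A t.
Proof. by move=> t0; rewrite [in RHS](splitr t) -psdpowD ?divr_ge0. Qed.

Lemma psdpow_swap m n (X : 'M[C]_(m, n)) t :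
  psdpow (X *m X ^t*) t *m X = X *m psdpow (X ^t* *m X) t.
Proof. by rewrite -!psdpowE; apply: mxpow_swap. Qed.

Lemma psdpow_mul0 m n (A : 'M[C]_m) (V : 'M_(m, n)) t : psdmx A -> t != 0 ->
  A *m V = 0 -> psdpow A t *m V = 0.
Proof. by rewrite -psdpowE; apply: mxpow_mul0. Qed.

Lemma psdpowZ n (A : 'M[C]_n) c t : psdmx A -> 0 <= c ->
  psdpow (c%:C%C *: A) t = (c `^ t)%:C%C *: psdpow A t.
Proof. by rewrite -!psdpowE; apply: mxpowZ. Qed.

Lemma psdpow_diag n (d : 'rV[C]_n) t : (forall i, 0 <= d 0 i) ->
  psdpow (diag_mx d) t =
  diag_mx (map_mx (fun z : C => ((complex.Re z) `^ t)%:C%C) d).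
Proof. by rewrite -psdpowE; apply: mxpow_diag. Qed.

Lemma spec_le_powl n M (A X : 'M[C]_n) t : 0 <= M -> 0 <= t -> psdmx X ->
  spec_le M (psdpow A t *m X) <->
  psdmx (M%:M - psdpow A (t / 2) *m X *m psdpow A (t / 2)).
Proof.
move=> M0 t0 pX; rewrite -(psdpow_half A t0).
exact: (spec_le_sandwich M0 (psdpow_adj _ _) pX).
Qed.

Lemma spec_le_mono n M (A X Z : 'M[C]_n) t : 0 <= M -> 0 <= t ->
  psdmx X -> psdmx Z -> psdmx (Z - X) ->
  spec_le M (psdpow A t *m Z) -> spec_le M (psdpow A t *m X).
Proof.
move=> M0 t0 pX pZ XZ /(spec_le_powl _ M0 t0 pZ) AZ.
apply/(spec_le_powl _ M0 t0 pX); apply: psdmx_le_trans AZ.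
by have := psdmx_congrB (psdpow A (t / 2)) XZ; rewrite psdpow_adj.
Qed.

Lemma spec_le_scale n M c (A X Z : 'M[C]_n) t : 0 <= M -> 0 < c -> 0 <= t ->
  psdmx X -> psdmx Z -> psdmx (c *: Z - X) ->
  spec_le M (psdpow A t *m Z) -> spec_le (c * M) (psdpow A t *m X).
Proof.
move=> M0 c0 t0 pX pZ XZ AZ.
have cM : 0 <= c * M by rewrite mulr_ge0 // ltW.
apply: (spec_le_mono cM t0 pX (psdmxZ (ltW c0) pZ) XZ).
by rewrite -scalemxAr; apply: spec_leZ.
Qed.

(* [X^m Y^m] with [m = (s + t) / 2] has the spectrum of the product of the
   contractions [Y^(t/2) X^(t/2)] and [X^(s/2) Y^(s/2)]. *)
Lemma spec_le_mid n (X Y : 'M[C]_n) s t : 0 <= s -> 0 <= t ->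
  spec_le 1 (psdpow X s *m psdpow Y s) -> spec_le 1 (psdpow X t *m psdpow Y t) ->
  spec_le 1 (psdpow X ((s + t) / 2) *m psdpow Y ((s + t) / 2)).
Proof.
move=> s0 t0 /(spec_le_powl _ ler01 s0 (psdpow_psd _ _)) XYs.
move=> /(spec_le_mulC ler01)/(spec_le_powl _ ler01 t0 (psdpow_psd _ _)) YXt.
have [s20 t20] : 0 <= s / 2 /\ 0 <= t / 2 by rewrite !divr_ge0.
pose W := psdpow Y (t / 2) *m psdpow X (t / 2).
pose Z := psdpow X (s / 2) *m psdpow Y (s / 2).
have pZ : psdmx (1%:M - (W *m Z) *m (W *m Z) ^t*).
  apply: psdmx_contrM.
    rewrite /W adjmxM (psdpow_adj X) (psdpow_adj Y) mulmxA.
    by rewrite -(mulmxA (psdpow Y _)) (psdpow_half X t0); exact: YXt.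
  rewrite /Z adjmxM (psdpow_adj X) (psdpow_adj Y) mulmxA.
  by rewrite -(mulmxA (psdpow X _)) (psdpow_half Y s0); exact: XYs.
apply/spec_leP => a ea; have a0 : 0 <= a.
  apply: (eigenvalues_psdM_ge0 (psdpow_psd X _) (psdpow_psd Y _)).
  by rewrite mem_eigenvalues; apply: ea.
have [->//|an0] := eqVneq a 0.
rewrite -(ger0_norm a0); apply: contr_eigenvalue pZ _.
have eX : psdpow X ((s + t) / 2) = psdpow X (t / 2) *m psdpow X (s / 2).
  by rewrite psdpowD // -mulrDl addrC.
have eY : psdpow Y ((s + t) / 2) = psdpow Y (s / 2) *m psdpow Y (t / 2).
  by rewrite psdpowD // -mulrDl.
move: ea; rewrite eX eY mulmxA => /(eigenvalue_mulC an0).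
by rewrite /W /Z !mulmxA.
Qed.

End Psdpow.

(** * The Cordes inequality, by approximation of the exponent *)

Section Cordes.
Variable R : realType.
Local Notation C := R[i].

(** Bisection: both ends of the nested intervals around [t] satisfy [P], and the left end of an
    interval of length at most [e] is the witness. *)
Lemma dyadic_dense (P : R -> Prop) : P 0 -> P 1 ->
  (forall s t, 0 <= s -> 0 <= t -> P s -> P t -> P ((s + t) / 2)) ->
  forall t e, 0 <= t <= 1 -> 0 < e ->
    exists u, [/\ 0 <= u, `|t - u| <= e & P u].
Proof.
move=> P0 P1 Pmid t e /andP[t0 t1] e0.
have step m : exists a b, [/\ 0 <= a, P a, P b, a <= t <= b & b - a = 2 ^- m].
  elim: m => [|m [a [b [a0 Pa Pb /andP[at_ tb] ab]]]].
    by exists 0, 1; rewrite t0 t1 subr0 expr0 invr1.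
  have b0 : 0 <= b by apply: le_trans tb.
  have e2 : (2 : R) ^- m.+1 = 2 ^- m / 2.
    by rewrite exprS invfM mulrC.
  have [tm|tm] := leP t ((a + b) / 2).
    exists a, ((a + b) / 2); split; rewrite ?at_ //; first exact: Pmid.
    by rewrite e2 -ab; field.
  exists ((a + b) / 2), b; split; rewrite ?(ltW tm) //.
  - by rewrite divr_ge0 ?addr_ge0.
  - exact: Pmid.
  - by rewrite e2 -ab; field.
have [m me] : exists m, (2 : R) ^- m <= e.
  exists (Num.truncn (e^-1)).+1; rewrite invf_ple ?posrE ?exprn_gt0 //.
  rewrite (le_trans (ltW (truncnS_gt _))) //.
  by rewrite -natrX ler_nat ltnW // ltn_expl.
have [a [b [a0 Pa Pb /andP[at_ tb] ab]]] := step m.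
exists a; split => //; rewrite ger0_norm ?subr_ge0 //.
by rewrite (le_trans _ me) // -ab lerB.
Qed.

(** A quantitative substitute for continuity in the exponent: since [K] bounds [x] and its inverse,
    [x^(t - u)] is at most [K^|t - u|] whatever the sign of [t - u]. At [x = 0] the left side
    vanishes because [0 < t]. *)
Lemma powR_approx (K x t u : R) : 1 <= K -> x <= K -> x^-1 <= K ->
  0 <= x -> 0 < t -> x `^ t <= K `^ `|t - u| * x `^ u.
Proof.
move=> K1 xK xVK; rewrite le_eqVlt => /predU1P[<-|x0] t0.
  by rewrite powR0 ?gt_eqF // mulr_ge0 ?powR_ge0.
have -> : x `^ t = x `^ (t - u) * x `^ u.
  by rewrite -powRD ?subrK // (gt_eqF x0) implybT.
rewrite ler_pM2r ?powR_gt0 //.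
have K0 : 0 <= K by apply: le_trans K1.
have [tu|tu] := leP 0 (t - u).
  by rewrite (ger0_norm tu); apply: ge0_ler_powR; rewrite ?nnegrE // ltW.
rewrite (ltr0_norm tu); have -> : x `^ (t - u) = (x^-1) `^ (- (t - u)).
  by rewrite -powR_inv1 ?(ltW x0) // -powRrM mulN1r opprK.
by apply: ge0_ler_powR; rewrite ?nnegrE ?invr_ge0 ?oppr_ge0 // ltW.
Qed.

(** The inverse of a zero eigenvalue is 0 by convention, so singular matrices are covered. *)
Lemma spectral_bound n (A : 'M[C]_n) : exists K : R, 1 <= K /\
  forall i, complex.Re (spectral_diag A 0 i) <= K /\
            (complex.Re (spectral_diag A 0 i))^-1 <= K.
Proof.
pose x i := complex.Re (spectral_diag A 0 i).
exists (1 + \sum_i (`|x i| + `|(x i)^-1|)); split=> [|i].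
  by rewrite lerDl sumr_ge0 // => i _; rewrite addr_ge0.
have le_sum : `|x i| + `|(x i)^-1| <= 1 + \sum_i (`|x i| + `|(x i)^-1|).
  rewrite (bigD1 i) //= addrCA lerDl addr_ge0 // sumr_ge0 // => j _.
  by rewrite addr_ge0.
split; apply: le_trans le_sum; apply: le_trans (ler_norm _) _.
  by rewrite lerDl.
by rewrite lerDr.
Qed.

Lemma psdpow_approx n (A : 'M[C]_n) (K t u : R) : psdmx A -> 1 <= K ->
  (forall i, complex.Re (spectral_diag A 0 i) <= K /\
            (complex.Re (spectral_diag A 0 i))^-1 <= K) -> 0 < t ->
  psdmx ((K `^ `|t - u|)%:C%C *: psdpow A u - psdpow A t).
Proof.
move=> pA K1 AK t0; rewrite -!psdpowE /mxpow mxfunZ mxfunB; apply: mxfun_ge0 => i.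
rewrite -rmorphM -rmorphB /= ler0c subr_ge0.
have [? ?] := AK i; apply: powR_approx => //.
by have := psdmx_spectral_diag_ge0 i pA; rewrite lecE => /andP[].
Qed.

(** The exponents for which the bound holds include 0 and 1 and are closed under midpoints, hence
    are dense in the unit interval. Passing from such an exponent [u] to [t] costs a factor
    [K^(2 |t - u|)], which tends to 1. *)
Lemma spec_le_powR n (X Y : 'M[C]_n) t : psdmx X -> psdmx Y -> 0 <= t <= 1 ->
  spec_le 1 (X *m Y) -> spec_le 1 (psdpow X t *m psdpow Y t).
Proof.
move=> pX pY t01 XY; apply/spec_leP => a ea.
have a0 : 0 <= a.
  apply: (eigenvalues_psdM_ge0 (psdpow_psd X t) (psdpow_psd Y t)).
  by rewrite mem_eigenvalues.
pose P u := spec_le 1 (psdpow X u *m psdpow Y u).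
have P0 : P 0.
  rewrite /P !psdpow0 mulmx1; apply/spec_leP => b /eigenvalueP[v].
  rewrite mulmx1 => vb v0.
  have /eqP : (1 - b) *: v = 0 by rewrite scalerBl -vb scale1r subrr.
  by rewrite scaler_eq0 (negPf v0) orbF subr_eq0 => /eqP <-.
have P1 : P 1 by rewrite /P !psdpow1.
have [t0|t0] := leP t 0.
  move: ea; rewrite (_ : t = 0) => [/(spec_leP _ _ P0)//|].
  by apply/le_anti; rewrite t0; case/andP: t01.
have [KX [KX1 bX]] := spectral_bound X; have [KY [KY1 bY]] := spectral_bound Y.
pose K := KX + KY.
have K1 : 1 <= K by rewrite /K; lra.
have {}bX i : complex.Re (spectral_diag X 0 i) <= K /\
            (complex.Re (spectral_diag X 0 i))^-1 <= K.
  by have [? ?] := bX i; rewrite /K; split; lra.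
have {}bY i : complex.Re (spectral_diag Y 0 i) <= K /\
            (complex.Re (spectral_diag Y 0 i))^-1 <= K.
  by have [? ?] := bY i; rewrite /K; split; lra.
have approx u : 0 <= u -> P u -> a <= ((K `^ `|t - u|) ^+ 2)%:C%C.
  set c := K `^ `|t - u| => u0 Pu; have c0 : 0 < c by rewrite powR_gt0; lra.
  have cC : 0 < c%:C%C :> C by rewrite ltcE /= eqxx.
  have YXu := spec_le_mulC ler01 Pu.
  have YX := spec_le_scale ler01 cC u0 (psdpow_psd X t) (psdpow_psd X u)
    (psdpow_approx u pX K1 bX t0) YXu.
  have c1 : 0 <= c%:C%C * 1 :> C by rewrite mulr1 ltW.
  have XYt := spec_le_scale c1 cC (ltW t0) (psdpow_psd Y t) (psdpow_psd Y u)
    (psdpow_approx u pY K1 bY t0) (spec_le_mulC c1 YX).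
  have := elimT (spec_leP _ _) XYt a ea.
  by rewrite mulr1 rmorphXn expr2.
case: a a0 approx {ea} => x y; rewrite lecE => /andP[/= /eqP -> x0] approx.
rewrite lecE /= eqxx /= leNgt; apply/negP => x1.
have lnx : 0 < ln x by apply: ln_gt0.
have lnK : 0 <= ln K by apply: ln_ge0.
(* Chosen so that [2 e ln K < ln x], that is [K^(2 e) < x], contradicting [approx]; the summand 1
   keeps the denominator positive when [K = 1]. *)
pose e := ln x / (2 * ln K + 1).
have e0 : 0 < e by rewrite divr_gt0 //; lra.
have [u [u0 tu Pu]] := dyadic_dense P0 P1 (@spec_le_mid _ _ X Y) t01 e0.
have := approx u u0 Pu; rewrite lecE /= eqxx /= leNgt => /negP; apply.
apply: (@le_lt_trans _ _ ((K `^ e) ^+ 2)).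
  by rewrite ler_pXn2r ?nnegrE ?powR_ge0 // ler_powR.
have Kgt0 : 0 < K by lra.
have x_gt0 : 0 < x by lra.
rewrite -ltr_ln ?posrE ?exprn_gt0 ?powR_gt0 //.
have eE : e * (2 * ln K + 1) = ln x by rewrite divfK //; lra.
rewrite lnXn ?powR_gt0 // ln_powR -eE mulr2n; lra.
Qed.

End Cordes.

(** * The Loewner-Heinz inequality *)

Section LoewnerHeinz.
Variable R : realType.
Local Notation C := R[i].

(** For positive semidefinite [A], this is the orthogonal projection onto the range of [A]. *)
Definition psdsupp n (A : 'M[C]_n) : 'M[C]_n :=
  mxfun (fun z : C => (complex.Re z != 0)%:R) A.

(* As [0 `^ a = 0] for [a != 0], negative powers are powers of the
   Moore-Penrose inverse. *)
Lemma psdpowN n (A : 'M[C]_n) a : a != 0 ->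
  psdpow A a *m psdpow A (- a) = psdsupp A.
Proof.
move=> a0; rewrite -!psdpowE /mxpow mxfunM; apply: eq_mxfun => i.
rewrite -rmorphM /=; have [->|x0] := eqVneq (complex.Re _) 0.
  by rewrite powR0 // mul0r.
by rewrite -powRD ?subrr ?powRr0 // x0 implybT.
Qed.

(** Unlike in [psdpowD], the exponents may be negative. At a zero eigenvalue both sides vanish,
    since [a + b != 0] makes one of [a], [b] nonzero. *)
Lemma psdpowDn n (A : 'M[C]_n) a b : a + b != 0 ->
  psdpow A a *m psdpow A b = psdpow A (a + b).
Proof.
move=> ab0; rewrite -!psdpowE /mxpow mxfunM; apply: eq_mxfun => i.
by rewrite -rmorphM /= powRD // (negPf ab0).
Qed.

Lemma psdsupp_adj n (A : 'M[C]_n) : (psdsupp A) ^t* = psdsupp A.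
Proof. by apply: mxfun_herm => z; apply: realn. Qed.

Lemma psdsupp_le1 n (A : 'M[C]_n) : psdmx (1%:M - psdsupp A).
Proof.
rewrite -(mxfun1 A) mxfunB; apply: mxfun_ge0 => i.
by case: (_ != 0); rewrite ?subrr ?subr0.
Qed.

Lemma psdmx_supp n (A : 'M[C]_n) : psdmx A -> A *m psdsupp A = A.
Proof.
move=> pA; have one0 : (1 : R) != 0 by apply: oner_neq0.
(* Associated from the left, the partial sums of the exponents are 2 and 1, never 0, as [psdpowDn]
   demands. *)
have e : psdpow A 1 *m (psdpow A 1 *m psdpow A (-1)) = psdpow A 1.
  have two0 : (1 + 1 : R) != 0 by rewrite -mulr2n pnatr_eq0.
  by rewrite mulmxA (psdpowDn _ two0) psdpowDn addrK.
by move: e; rewrite (psdpowN A one0) (psdpow1 pA).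
Qed.

Lemma psdsupp_id n (A : 'M[C]_n) : psdsupp A *m psdsupp A = psdsupp A.
Proof.
rewrite /psdsupp mxfunM; apply: eq_mxfun => i.
by case: (_ != 0); rewrite ?mulr1 ?mulr0.
Qed.

(** The projection [S] onto the kernel of [Y] gives [0 <= S X S <= S Y S = 0], so
    [X^(1/2) S = 0]. *)
Lemma psdmx_le_supp n (X Y : 'M[C]_n) : psdmx X -> psdmx (Y - X) ->
  X *m (1%:M - psdsupp Y) = 0.
Proof.
move=> pX XY; set S := 1%:M - psdsupp Y.
have pY : psdmx Y by rewrite -(subrK X Y); apply: psdmxD.
have Sh : S ^t* = S by rewrite adjmxB psdsupp_adj adjmx_scalar conjC1.
have YS0 : Y *m S = 0 by rewrite mulmxBr mulmx1 psdmx_supp ?subrr.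
have SXS : S *m X *m S = 0.
  apply: psdmx_eq0; first by rewrite -{1}Sh; apply: psdmx_congr.
  have := psdmx_congrB S XY.
  by rewrite Sh -(mulmxA S Y) YS0 mulmx0 sub0r.
have h0 : (0 : R) <= 2^-1 by rewrite invr_ge0.
have X2 : psdpow X 2^-1 *m psdpow X 2^-1 = X.
  by rewrite psdpowD // -[RHS]psdpow1 // [in RHS](splitr 1) mul1r.
have /adjmx_eq0 XS : (psdpow X 2^-1 *m S) ^t* *m (psdpow X 2^-1 *m S) = 0.
  by rewrite adjmxM Sh psdpow_adj mulmxA -(mulmxA S) X2.
by rewrite -X2 -mulmxA XS mulmx0.
Qed.

(** [X <= Y] says that the spectrum of [Y^-1 X] is at most 1, and the Cordes inequality raises this
    to the power [t]. For singular [Y] the inverse is the Moore-Penrose one; the remaining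
    projections [psdsupp Y] are absorbed by [X^t], whose range lies in that of [Y]. *)
Lemma loewner_heinz n (X Y : 'M[C]_n) t : psdmx X -> psdmx (Y - X) ->
  0 <= t <= 1 -> psdmx (psdpow Y t - psdpow X t).
Proof.
move=> pX XY /andP[t_ge0 t1].
have pY : psdmx Y by rewrite -(subrK X Y); apply: psdmxD.
move: t_ge0; rewrite le_eqVlt => /predU1P[<-|t0].
  by rewrite !psdpow0 subrr; apply: psdmx0.
have h0 : - (2^-1 : R) != 0 by rewrite oppr_eq0 invr_eq0 pnatr_eq0.
have th0 : t / 2 != 0 by rewrite mulf_neq0 ?invr_eq0 ?pnatr_eq0 ?gt_eqF.
set J := psdpow Y (- 2^-1); have Jh : J ^t* = J by apply: psdpow_adj.
have JJ : J *m J = psdpow Y (- 1).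
  have e : - (2^-1 : R) - 2^-1 = -1 by rewrite -opprD -[2^-1]mul1r -splitr.
  by rewrite psdpowDn e ?oppr_eq0 ?oner_eq0.
have JYJ : J *m Y *m J = psdsupp Y.
  have Y2 : Y = psdpow Y 2^-1 *m psdpow Y 2^-1.
    by rewrite psdpowD ?invr_ge0 // -[LHS]psdpow1 // [in LHS](splitr 1) mul1r.
  have YJ : psdpow Y 2^-1 *m J = psdsupp Y by apply: psdpowN; rewrite -oppr_eq0.
  have JY : J *m psdpow Y 2^-1 = psdsupp Y by have := psdpowN Y h0; rewrite opprK.
  by rewrite {1}Y2 mulmxA JY -mulmxA YJ psdsupp_id.
have pJX : psdmx (1%:M - J *m X *m J).
  apply: psdmx_le_trans (psdsupp_le1 Y); rewrite -JYJ.
  by have := psdmx_congrB J XY; rewrite Jh.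
have YX : spec_le 1 (psdpow Y (- 1) *m X).
  by rewrite -JJ; apply/(spec_le_sandwich ler01 Jh pX).
have t01 : 0 <= t <= 1 by rewrite ltW.
have := spec_le_powR (psdpow_psd Y (-1)) pX t01 YX; rewrite psdpowM mulN1r.
have -> : psdpow Y (- t) = psdpow Y (- (t / 2)) *m psdpow Y (- (t / 2)).
  by rewrite psdpowDn -opprD -splitr // oppr_eq0 gt_eqF.
set K := psdpow Y (- (t / 2)); set L := psdpow Y (t / 2).
have Kh : K ^t* = K by apply: psdpow_adj.
have LK : L *m K = psdsupp Y by apply: psdpowN.
have KL : K *m L = psdsupp Y.
  by have := @psdpowN _ Y (- (t / 2)); rewrite opprK; apply; rewrite oppr_eq0.
move/(spec_le_sandwich ler01 Kh (psdpow_psd X t))/(psdmx_congrB L).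
rewrite psdpow_adj mulmx1 (psdpow_half Y (ltW t0)) !mulmxA LK -(mulmxA _ K) KL.
have Xt : psdpow X t *m psdsupp Y = psdpow X t.
  have /eqP := psdpow_mul0 pX (lt0r_neq0 t0) (psdmx_le_supp pX XY).
  by rewrite mulmxBr mulmx1 subr_eq0 => /eqP.
have tX : psdsupp Y *m psdpow X t = psdpow X t.
  by have := congr1 (fun Z => Z ^t*) Xt; rewrite adjmxM psdsupp_adj psdpow_adj.
by rewrite tX Xt.
Qed.

End LoewnerHeinz.

(** * The bound on the largest eigenvalue *)

Section Core.
Variable R : realType.
Local Notation C := R[i].

Lemma cordes n (A B : 'M[C]_n) (a b c : R) : 0 <= c <= 1 ->
  spec_le 1 (psdpow A a *m psdpow B b) ->
  spec_le 1 (psdpow A (a * c) *m psdpow B (b * c)).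
Proof.
by move=> c01 /(spec_le_powR (psdpow_psd A a) (psdpow_psd B b) c01); rewrite !psdpowM.
Qed.

(** Formally, this is [X <= A^-a] conjugated by [A^((a + e) / 2)]; no inverse of [A] is left, so [A]
    may be singular. *)
Lemma spec_le_relax n (A X : 'M[C]_n) (a e : R) : 0 <= a -> 0 <= e -> psdmx X ->
  spec_le 1 (psdpow A a *m X) ->
  psdmx (psdpow A e - psdpow A ((a + e) / 2) *m X *m psdpow A ((a + e) / 2)).
Proof.
move=> a0 e0 pX /(spec_le_powl A ler01 a0 pX) H.
have [a20 e20] : 0 <= a / 2 /\ 0 <= e / 2 by rewrite !divr_ge0.
have eL : psdpow A ((a + e) / 2) = psdpow A (e / 2) *m psdpow A (a / 2).
  by rewrite psdpowD // -mulrDl addrC.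
have eR : psdpow A ((a + e) / 2) = psdpow A (a / 2) *m psdpow A (e / 2).
  by rewrite psdpowD // -mulrDl.
have := psdmx_congrB (psdpow A (e / 2)) H.
rewrite psdpow_adj mulmx1 (psdpow_half A e0) {1}eL eR !mulmxA.
by apply: id.
Qed.

(** * Bounds on all powers of the conjugated matrix, by induction on the exponent *)

Section Chain.
Variables (n : nat) (A B : 'M[C]_n) (r s : R).
Hypotheses (pA : psdmx A) (pB : psdmx B) (s1 : 1 <= s) (r0 : 0 <= r).
Hypothesis AB : spec_le 1 (psdpow A (r + s) *m psdpow B s).
Let D := psdpow A 2^-1 *m B *m psdpow A 2^-1.
Let half0 : 0 <= 2^-1 :> R. Proof. by rewrite invr_ge0. Qed.
Let s0 : 0 < s. Proof. exact: lt_le_trans s1. Qed.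
Let rs0 : 0 < r + s. Proof. exact: ltr_wpDl. Qed.

Lemma conj_psd : psdmx D.
Proof. by rewrite /D -{1}(psdpow_adj A); apply: psdmx_congr. Qed.

(** The exponent for which [B^s <= A^-(r + s)] formally yields [B^(beta tau) <= A^-(1 + r tau / s)],
    so that conjugation by [A^(1/2)] leaves [A^-(r tau / s)]. *)
Let beta tau := (s + r * tau) / (r + s).

(** Once [A^(1/2)] is moved around cyclically, the claim for the larger matrix becomes a bound on
    [A^(1 + r tau / s) B^(beta tau)], an instance of [cordes]. *)
Lemma conj_finish tau : 0 <= tau <= s ->
  psdmx (psdpow A 2^-1 *m psdpow B (beta tau) *m psdpow A 2^-1 - psdpow D tau) ->
  spec_le 1 (psdpow A (r * tau / s) *m psdpow D tau).
Proof.
move=> /andP[t0 ts]; have rt0 : 0 <= r * tau by rewrite mulr_ge0.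
have rts : 0 <= r * tau / s by rewrite divr_ge0 // ltW.
set Z := (X in psdmx (X - _)); have pZ : psdmx Z.
  by rewrite /Z -{1}(psdpow_adj A); apply: psdmx_congr; apply: psdpow_psd.
move=> ZD; apply: (spec_le_mono ler01 rts (psdpow_psd _ _) pZ ZD).
rewrite /Z mulmxA; apply: (spec_le_mulC ler01); rewrite !mulmxA.
rewrite (psdpowD A half0 rts) (psdpowD A (addr_ge0 half0 rts) half0).
(* Both exponents are those of [AB] times the same factor, which is at most 1 because [tau <= s] and
   [1 <= s]. *)
have -> : 2^-1 + r * tau / s + 2^-1 = (r + s) * ((s + r * tau) / (s * (r + s))).
  by field; rewrite !gt_eqF.
have -> : beta tau = s * ((s + r * tau) / (s * (r + s))).
  by rewrite /beta; field; rewrite !gt_eqF.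
apply: cordes AB; rewrite divr_ge0 ?addr_ge0 ?mulr_ge0 ?(ltW s0) ?(ltW rs0) //=.
rewrite ler_pdivrMr ?mulr_gt0 // mul1r.
have rts_le : r * tau <= r * s by rewrite ler_wpM2l.
have ss : s <= s * s by rewrite ler_peMl // ltW.
rewrite mulrDr addrC (mulrC s r); exact: lerD rts_le ss.
Qed.

(** [cordes] with exponent [1 / s] bounds [A^((r + s) / s) B], which is cyclically [A^(r / s) D];
    the power [tau] of that bound is the claim. *)
Lemma conj_base tau : 0 <= tau <= 1 ->
  spec_le 1 (psdpow A (r * tau / s) *m psdpow D tau).
Proof.
move=> t01; have rs : 0 <= r / s by rewrite divr_ge0 // ltW.
have s01 : 0 <= s^-1 <= 1 by rewrite invr_ge0 (ltW s0) invf_le1.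
have ABs := cordes s01 AB; rewrite (mulfV (lt0r_neq0 s0)) (psdpow1 pB) in ABs.
have AD : spec_le 1 (psdpow A (r / s) *m D).
  rewrite /D !mulmxA; apply: (spec_le_mulC ler01); rewrite !mulmxA.
  rewrite (psdpowD A half0 rs) (psdpowD A (addr_ge0 half0 rs) half0).
  suff <- : (r + s) * s^-1 = 2^-1 + r / s + 2^-1 by exact: ABs.
  by field; rewrite gt_eqF.
have := spec_le_powR (psdpow_psd A (r / s)) conj_psd t01 AD.
by rewrite psdpowM mulrAC.
Qed.

(** Formally [A <= B^(-s / (r + s))] by [cordes], hence [E <= B^(r / (r + s))]. Loewner-Heinz with
    exponent [tau - 1] and conjugation by [X] then give [B] the exponent
    [1 + r (tau - 1) / (r + s) = beta tau]. *)
Lemma conj_mid tau : 1 <= tau <= 2 -> tau <= s ->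
  spec_le 1 (psdpow A (r * tau / s) *m psdpow D tau).
Proof.
move=> /andP[t1 t2] ts; apply: conj_finish; first by rewrite ts andbT; lra.
pose X := psdpow A 2^-1 *m psdpow B 2^-1.
have Xa : X ^t* = psdpow B 2^-1 *m psdpow A 2^-1 by rewrite /X adjmxM !psdpow_adj.
have half2 : (2^-1 : R) + 2^-1 = 1 by field.
have B2 : psdpow B 2^-1 *m psdpow B 2^-1 = B by rewrite psdpowD // half2 psdpow1.
have A2 : psdpow A 2^-1 *m psdpow A 2^-1 = A by rewrite psdpowD // half2 psdpow1.
have XX : X *m X ^t* = D by rewrite Xa /X mulmxA -(mulmxA _ _ (psdpow B _)) B2.
pose E := X ^t* *m X.
have EE : E = psdpow B 2^-1 *m A *m psdpow B 2^-1.
  by rewrite /E Xa /X mulmxA -(mulmxA _ _ (psdpow A _)) A2.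
have Dt : psdpow D tau = X *m psdpow E (tau - 1) *m X ^t*.
  rewrite -psdpow_swap XX -mulmxA XX -{3}(psdpow1 conj_psd) psdpowD ?subrK //.
  by rewrite subr_ge0.
have r_rs : 0 <= s / (r + s) <= 1.
  apply/andP; split; first exact: divr_ge0 (ltW s0) (ltW rs0).
  by rewrite ler_pdivrMr // mul1r lerDr.
have BA : spec_le 1 (psdpow B (s / (r + s)) *m A).
  apply: (spec_le_mulC ler01); rewrite -{1}(psdpow1 pA).
  have rsV : 0 <= (r + s)^-1 <= 1.
    by rewrite invr_ge0 (ltW rs0) invf_le1 //; apply: ler_wpDl.
  by have := cordes rsV AB; rewrite (mulfV (lt0r_neq0 rs0)); apply: id.
have EB : psdmx (psdpow B (r / (r + s)) - E).
  have := @spec_le_relax _ _ _ _ (r / (r + s)) _ _ pA BA.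
  have -> : s / (r + s) + r / (r + s) = 1 by field; rewrite gt_eqF.
  by rewrite mul1r -EE; apply; [case/andP: r_rs|exact: divr_ge0 r0 (ltW rs0)].
have pE : psdmx E by rewrite EE -{1}(psdpow_adj B); apply: psdmx_congr.
have t01 : 0 <= tau - 1 <= 1 by lra.
have := psdmx_congrB (X ^t*) (loewner_heinz pE EB t01).
rewrite trmxCK -Dt psdpowM {1}/X Xa !mulmxA.
rewrite -!(mulmxA (psdpow A _)).
have rr0 : 0 <= r / (r + s) * (tau - 1).
  by rewrite mulr_ge0 ?divr_ge0 ?(ltW rs0) //; lra.
rewrite (psdpowD B half0 rr0) (psdpowD B (addr_ge0 half0 rr0) half0).
suff -> : 2^-1 + r / (r + s) * (tau - 1) + 2^-1 = beta tau by apply: id.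
by rewrite /beta; field; rewrite gt_eqF.
Qed.

(** The hypothesis on [D^(tau - 2)] gives [A^(1/2) D^(tau - 2) A^(1/2) <= A^(1 - a)], and
    conjugation by [B A^(1/2)] gives [D^tau <= A^(1/2) B A^(1 - a) B A^(1/2)]. Since [a <= 1],
    formally [A^(1 - a) <= B^(-s c)], whence [B A^(1 - a) B <= B^(2 - s c)] with
    [2 - s c = beta tau]. *)
Lemma conj_step tau : 2 < tau <= s -> r * (tau - 2) <= s ->
  spec_le 1 (psdpow A (r * (tau - 2) / s) *m psdpow D (tau - 2)) ->
  spec_le 1 (psdpow A (r * tau / s) *m psdpow D tau).
Proof.
move=> /andP[t2 ts] rts IH; apply: conj_finish; first by rewrite ts andbT; lra.
set a := r * (tau - 2) / s in IH.
have a0 : 0 <= a by rewrite divr_ge0 ?mulr_ge0 ?(ltW s0) //; lra.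
have a1 : a <= 1 by rewrite /a ler_pdivrMr // mul1r.
have ADA : psdmx (psdpow A (1 - a) -
    psdpow A 2^-1 *m psdpow D (tau - 2) *m psdpow A 2^-1).
  have a10 : 0 <= 1 - a by rewrite subr_ge0.
  have := spec_le_relax a0 a10 (psdpow_psd _ _) IH.
  by rewrite (addrC a) subrK mul1r; apply: id.
have DD : (B *m psdpow A 2^-1) ^t* *m
    (psdpow A 2^-1 *m psdpow D (tau - 2) *m psdpow A 2^-1) *m
    (B *m psdpow A 2^-1) = psdpow D tau.
  transitivity (D *m psdpow D (tau - 2) *m D).
    set P := psdpow D _.
    by rewrite adjmxM psdpow_adj (psdmx_adj pB) /D !mulmxA.
  have pD := conj_psd; have t20 : 0 <= tau - 2 by lra.
  have t10 : 0 <= tau - 1 by lra.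
  rewrite -{1}(psdpow1 pD) (psdpowD D ler01 t20).
  rewrite (_ : 1 + (tau - 2) = tau - 1); last by ring.
  by rewrite -{2}(psdpow1 pD) (psdpowD D t10 ler01) subrK.
have := psdmx_congrB (B *m psdpow A 2^-1) ADA; rewrite {}DD => H1.
pose c := (1 - a) / (r + s).
have c0 : 0 <= c by rewrite divr_ge0 ?(ltW rs0) // subr_ge0.
have c1 : c <= 1.
  by rewrite ler_pdivrMr // mul1r lerBlDr (le_trans s1) // -addrA ler_wpDl // lerDl.
have sc1 : s * c <= 1.
  rewrite /c mulrA ler_pdivrMr // mul1r mulrBr mulr1.
  by have := mulr_ge0 (ltW s0) a0; have := r0; lra.
have cc : 0 <= c <= 1 by rewrite c0.
have ABc := spec_le_mulC ler01 (cordes cc AB).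
have rsc : (r + s) * c = 1 - a by rewrite mulrC divfK // gt_eqF.
rewrite rsc in ABc.
have sc0 : 0 <= s * c by rewrite mulr_ge0 // ltW.
have e0 : 0 <= 2 - s * c by lra.
have := spec_le_relax sc0 e0 (psdpow_psd _ _) ABc.
rewrite (_ : (s * c + (2 - s * c)) / 2 = 1); last by field.
rewrite (psdpow1 pB) => /(psdmx_congrB (psdpow A 2^-1)).
rewrite psdpow_adj (_ : 2 - s * c = beta tau); last first.
  by rewrite /c /a /beta; field; rewrite !gt_eqF.
have -> : psdpow A 2^-1 *m (B *m psdpow A (1 - a) *m B) *m psdpow A 2^-1 =
  (B *m psdpow A 2^-1) ^t* *m psdpow A (1 - a) *m (B *m psdpow A 2^-1).
  by rewrite adjmxM psdpow_adj (psdmx_adj pB) !mulmxA.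
exact: psdmx_le_trans.
Qed.

(** Steps of length 2 bring [tau] down to at most 2; the induction is on an integer bound for [tau].
    The condition on [r] passes to [tau - 2] because [0 <= r]. *)
Lemma conj_powers tau : 0 <= tau <= s -> tau <= 2 \/ r * (tau - 2) <= s ->
  spec_le 1 (psdpow A (r * tau / s) *m psdpow D tau).
Proof.
have [m] : exists m : nat, tau <= m%:R.
  by exists (Num.truncn tau).+1; rewrite ltW // truncnS_gt.
elim: m tau => [|m IHm] tau tm /andP[t0 ts] tr.
  by apply: conj_base; rewrite t0 (le_trans tm).
have [t1|t1] := leP tau 1; first by apply: conj_base; rewrite t0.
have [t2|t2] := leP tau 2; first by apply: conj_mid => //; rewrite ltW.
have {}tr : r * (tau - 2) <= s by case: tr => //; rewrite leNgt t2.
have t2s : 2 < tau <= s by rewrite t2.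
apply: (conj_step t2s tr); apply: IHm.
- by move: tm; rewrite -natr1; lra.
- by lra.
- by right; apply: le_trans tr; rewrite ler_wpM2l // lerBlDr lerDl.
Qed.

End Chain.

(** Homogeneity: with [c = M^(-1 / s)], replacing [B] by [c B] divides both products by [M], and
    [conj_powers] applies at [tau = s]. *)
Lemma spec_le_psdpow_conj n (A B : 'M[C]_n) (r s M : R) : psdmx A -> psdmx B ->
  1 <= s -> 0 <= r -> s <= 2 \/ r * (s - 2) <= s -> 0 < M ->
  spec_le M%:C%C (psdpow A (r + s) *m psdpow B s) ->
  spec_le M%:C%C
    (psdpow A r *m psdpow (psdpow A 2^-1 *m B *m psdpow A 2^-1) s).
Proof.
move=> pA pB s1 r0 sr M0 AB; have s0 : 0 < s by apply: lt_le_trans s1.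
set D := psdpow A 2^-1 *m B *m psdpow A 2^-1.
have pD : psdmx D by apply: conj_psd.
have M0C : 0 < M%:C%C :> C by rewrite ltcE /= eqxx.
have MC0 : 0 < M%:C%C^-1 :> C by rewrite invr_gt0.
pose c := M `^ (- s^-1); have c0 : 0 <= c by apply: powR_ge0.
have cs : (c `^ s)%:C%C = M%:C%C^-1 :> C.
  by rewrite -powRrM mulNr mulVf ?gt_eqF // powR_inv1 ?ltW // fmorphV.
have pcB : psdmx (c%:C%C *: B) by apply: psdmxZ; rewrite ?ler0c.
have ABM := spec_leZ MC0 AB.
rewrite (mulVf (lt0r_neq0 M0C)) scalemxAr -cs -(psdpowZ s pB c0) in ABM.
have s0s : 0 <= s <= s by rewrite ltW /=.
have := conj_powers pA pcB s1 r0 ABM s0s sr.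
rewrite (mulfK (lt0r_neq0 s0)) -scalemxAr -scalemxAl -/D (psdpowZ s pD c0) cs.
rewrite -scalemxAr => /(spec_leZ M0C).
rewrite mulr1 scalerA (mulfV (lt0r_neq0 M0C)) scale1r; exact: id.
Qed.

End Core.

(** * Exterior powers *)

(** Block elimination computes the determinant of [M] in two ways, the second one up to the factor
    ['X^n], which cancels in a domain. *)
Lemma char_poly_mulC (F : idomainType) n (A B : 'M[F]_n) :
  char_poly (A *m B) = char_poly (B *m A).
Proof.
pose a := map_mx polyC A; pose b := map_mx polyC B.
pose T : 'M[{poly F}]_n := 'X%:M.
pose M := block_mx T a b (1%:M : 'M_n).
have detM : \det M = \det (T - a *m b).
  have : M *m block_mx 1%:M 0 (- b) 1%:M = block_mx (T - a *m b) a 0 1%:M.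
    by rewrite mulmx_block !mulmx1 !mulmx0 !mulmxN !mul1mx !add0r subrr.
  move/(congr1 determinant); rewrite det_mulmx det_lblock det_ublock !det1.
  by rewrite !mulr1.
have XdetM : 'X^n * \det M = 'X^n * \det (T - b *m a).
  have : block_mx 1%:M 0 (- b) T *m M = block_mx T a 0 (T - b *m a).
    rewrite mulmx_block !mul1mx !mul0mx !addr0 mulmx1 mulNmx scalar_mxC.
    by rewrite addNr mulNmx addrC.
  move/(congr1 determinant); rewrite det_mulmx det_lblock det_ublock !det1.
  by rewrite mul1r det_scalar.
have X0 : ('X^n : {poly F}) != 0 by rewrite monic_neq0 // monicXn.
rewrite /char_poly /char_poly_mx !map_mxM -/a -/b -/T -detM.
exact: (mulfI X0).
Qed.

Section Compound.
Variables (F : numFieldType) (n k : nat).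
Local Notation I := {ffun 'I_k -> 'I_n}.

Definition minor_mx (T : 'M[F]_n) (f g : I) : 'M[F]_k := \matrix_(i, j) T (f i) (g j).

(* The [k]-th exterior power, on the whole of the [k]-th tensor power: rows and
   columns are indexed by all maps 'I_k -> 'I_n rather than by the increasing
   ones, which makes the Cauchy-Binet formula a plain matrix product but sends
   the identity to a projection. *)
Definition compound (T : 'M[F]_n) : 'M[F]_#|{: I}| :=
  \matrix_(a, b) (k`!%:R^-1 * \det (minor_mx T (enum_val a) (enum_val b))).

Lemma det_minorM (S T : 'M[F]_n) (f h : I) :
  \det (minor_mx (S *m T) f h) =
  \sum_(g : I) (\prod_i S (f i) (g i)) * \det (minor_mx T g h).
Proof.
pose G (s : 'S_k) i l := S (f i) l * T l (h (s i)).
transitivity (\sum_(s : 'S_k) \sum_(g : I) (-1) ^+ s * \prod_i G s i (g i)).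
  apply: eq_bigr => s _; rewrite -big_distrr /=; congr (_ * _).
  by rewrite -(bigA_distr_bigA (G s)); apply: eq_bigr => i _; rewrite !mxE.
rewrite exchange_big /=; apply: eq_bigr => g _; rewrite big_distrr /=.
apply: eq_bigr => s _; rewrite mulrCA big_split //=; congr (_ * (_ * _)).
by apply: eq_bigr => i _; rewrite mxE.
Qed.

(** Each set of [k] columns is met by [k!] injective maps [g], whence the factor [k!] and the
    normalization in [compound]. After expansion of the first determinant every permutation
    contributes the same amount. *)
Lemma cauchy_binet (S T : 'M[F]_n) (f h : I) :
  \sum_(g : I) \det (minor_mx S f g) * \det (minor_mx T g h) =
  k`!%:R * \det (minor_mx (S *m T) f h).
Proof.
transitivity (\sum_(s : 'S_k) \det (minor_mx (S *m T) f h)); last first.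
  by rewrite sumr_const card_Sn mulr_natl.
transitivity (\sum_(s : 'S_k) \sum_(g : I)
  (-1) ^+ s * (\prod_i S (f i) (g (s i))) * \det (minor_mx T g h)).
  rewrite exchange_big /=; apply: eq_bigr => g _; rewrite -big_distrl /=.
  congr (_ * _); apply: eq_bigr => s _; congr (_ * _).
  by apply: eq_bigr => i _; rewrite mxE.
apply: eq_bigr => s _; rewrite det_minorM.
(* Composing [g] with [s] permutes the rows of the minor of [T], and the sign this produces accounts
   for [(-1) ^+ s]. *)
pose c (t : 'S_k) (g : I) : I := [ffun i => g (t i)].
have cK : cancel (c s) (c s^-1)%g.
  by move=> g; apply/ffunP => i; rewrite !ffunE permKV.
have Kc : cancel (c s^-1)%g (c s).
  by move=> g; apply/ffunP => i; rewrite !ffunE permK.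
rewrite [RHS](reindex (c s)) /=; last by exists (c s^-1)%g => g _.
apply: eq_bigr => g _.
have -> : minor_mx T (c s g) h = row_perm s (minor_mx T g h).
  by apply/matrixP => i j; rewrite !mxE ffunE.
rewrite row_permE det_mulmx det_perm mulrCA mulrA; congr (_ * _ * _).
by apply: eq_bigr => i _; rewrite ffunE.
Qed.

Lemma compoundM (S T : 'M[F]_n) : compound S *m compound T = compound (S *m T).
Proof.
apply/matrixP => a b; rewrite !mxE.
have k0 : (k`!%:R : F) != 0 by rewrite pnatr_eq0 -lt0n fact_gt0.
have := cauchy_binet S T (enum_val a) (enum_val b).
rewrite (reindex _ (onW_bij _ (@enum_val_bij I))) /=.
move=> cb; rewrite -[\det _ in RHS](mulKf k0) -cb !big_distrr /=.
by apply: eq_bigr => c _; rewrite !mxE mulrACA !mulrA.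
Qed.

(** Candidate eigenvalues for the exterior power of [diag_mx d]; the entries at non-injective maps
    are annihilated by [compound 1%:M], which leaves the products over distinct indices. *)
Definition prod_diag (d : 'rV[F]_n) : 'rV[F]_#|{: I}| :=
  \row_b \prod_i d 0 ((enum_val b : I) i).

Lemma compound_mul_diag (M : 'M[F]_n) d :
  compound (M *m diag_mx d) = compound M *m diag_mx (prod_diag d).
Proof.
rewrite [RHS]mul_mx_diag; apply/matrixP => a b; rewrite !mxE -mulrA; congr (_ * _).
pose e : 'rV[F]_k := \row_i d 0 ((enum_val b : I) i).
have -> : minor_mx (M *m diag_mx d) (enum_val a) (enum_val b) =
          minor_mx M (enum_val a) (enum_val b) *m diag_mx e.
  by rewrite !mul_mx_diag; apply/matrixP => i j; rewrite !mxE.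
rewrite det_mulmx det_diag; congr (_ * _).
by apply: eq_bigr => i _; rewrite mxE.
Qed.

Lemma compound_diag_mul (M : 'M[F]_n) d :
  compound (diag_mx d *m M) = diag_mx (prod_diag d) *m compound M.
Proof.
rewrite [RHS]mul_diag_mx; apply/matrixP => a b; rewrite !mxE mulrCA; congr (_ * _).
pose e : 'rV[F]_k := \row_i d 0 ((enum_val a : I) i).
have -> : minor_mx (diag_mx d *m M) (enum_val a) (enum_val b) =
          diag_mx e *m minor_mx M (enum_val a) (enum_val b).
  by rewrite !mul_diag_mx; apply/matrixP => i j; rewrite !mxE.
rewrite det_mulmx det_diag; congr (_ * _).
by apply: eq_bigr => i _; rewrite mxE.
Qed.

Lemma compound1_noninj a b : ~~ injectiveb (enum_val b : I) -> compound 1%:M a b = 0.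
Proof.
case/injectivePn => i [j ij eij]; rewrite mxE -det_tr.
by rewrite (determinant_alternate ij) ?mulr0 // => l; rewrite !mxE eij.
Qed.

Lemma compound1_inj a : injective (enum_val a : I) -> compound 1%:M a a != 0.
Proof.
move=> inj_a; rewrite mxE (_ : minor_mx _ _ _ = 1%:M).
  by rewrite det1 mulr1 invr_eq0 pnatr_eq0 -lt0n fact_gt0.
by apply/matrixP => i j; rewrite !mxE (inj_eq inj_a).
Qed.

End Compound.

Lemma compound_adj (C : numClosedFieldType) n k (T : 'M[C]_n) :
  (compound k T) ^t* = compound k (T ^t*).
Proof.
apply/matrixP => a b; rewrite !mxE rmorphM fmorphV rmorph_nat; congr (_ * _).
rewrite -det_map_mx -det_tr; congr determinant.
by apply/matrixP => i j; rewrite !mxE.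
Qed.

(** * Products of largest eigenvalues *)

Section TopProduct.
Variable C : numClosedFieldType.

(** Among [m + 1] distinct indices one is at least [m]; its factor is at most [e m], and induction
    handles the others. *)
Lemma prod_top_le (e : nat -> C) (s : seq nat) :
  (forall i, 0 <= e i) -> (forall i j, (i <= j)%N -> e j <= e i) -> uniq s ->
  \prod_(i <- s) e i <= \prod_(i < size s) e i.
Proof.
move=> e0 e_anti; move sz : (size s) => m.
elim: m s sz => [|m IHm] s sz us.
  by rewrite (size0nil sz) big_nil big_ord0.
have [x xs mx] : exists2 x, x \in s & (m <= x)%N.
  apply/hasP; apply/negPn/negP; rewrite -all_predC => /allP sm.
  have /(uniq_leq_size us) : {subset s <= iota 0 m}.
    by move=> x /sm /=; rewrite -ltnNge mem_iota.
  by rewrite size_iota sz ltnn.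
rewrite (perm_big _ (perm_to_rem xs)) big_cons big_ord_recr /= mulrC.
apply: ler_pM => //; [exact: prodr_ge0 | | exact: e_anti].
by apply: IHm; rewrite ?rem_uniq // size_rem // sz.
Qed.

Lemma spectral_diag_perm n (H : 'M[C]_n) : H \is normalmx ->
  perm_eq (eigenvalues H) [seq spectral_diag H 0 i | i <- enum 'I_n].
Proof.
move=> /orthomx_spectralP eH; apply: prod_XsubC_eq.
rewrite -char_poly_eigenvalues {1}eH -mulmxA char_poly_mulC mulmxK ?spectral_unit //.
rewrite char_poly_trig ?diag_mx_is_trig // big_map big_enum /=.
by apply: eq_bigr => i _; rewrite mxE eqxx mulr1n.
Qed.

Lemma eigenvalues_psd_ge0 n (H : 'M[C]_n) : psdmx H ->
  {in eigenvalues H, forall z, 0 <= z}.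
Proof. by move=> pH z; rewrite mem_eigenvalues; apply: psdmx_eigenvalue. Qed.

Lemma nth_eigenvalues_ge0 n (X : 'M[C]_n) i :
  {in eigenvalues X, forall z, 0 <= z} -> 0 <= (eigenvalues X)`_i.
Proof.
move=> X0; have [ltis|geis] := ltnP i (size (eigenvalues X)).
  exact/X0/mem_nth.
by rewrite nth_default.
Qed.

Lemma nth_eigenvalues_anti n (X : 'M[C]_n) i j :
  {in eigenvalues X, forall z, 0 <= z} -> (i <= j)%N ->
  (eigenvalues X)`_j <= (eigenvalues X)`_i.
Proof.
move=> X0 ij; have [ltjs|gejs] := ltnP j (size (eigenvalues X)).
  have tr : transitive (fun x y : C => y <= x).
    by move=> y x z yx zy; apply: le_trans zy yx.
  have rf : reflexive (fun x y : C => y <= x) by move=> x; apply: lexx.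
  apply: (sorted_leq_nth tr rf 0 (sorted_eigenvalues X0)) => //.
  exact: leq_ltn_trans ltjs.
by rewrite (nth_default _ gejs) nth_eigenvalues_ge0.
Qed.

Lemma spectral_diag_nth n (H : 'M[C]_n) : H \is normalmx ->
  exists p : 'S_n, forall i, spectral_diag H 0 i = (eigenvalues H)`_(p i).
Proof.
move=> nH; have sz := size_eigenvalues H.
pose t : n.-tuple C := Tuple (introT eqP sz).
pose u := [tuple spectral_diag H 0 i | i < n].
have : perm_eq u t by rewrite perm_sym; apply: spectral_diag_perm.
move=> /tuple_permP[p up]; exists p => i.
have -> : spectral_diag H 0 i = u`_i by rewrite -tnth_nth tnth_mktuple.
by rewrite up -tnth_nth tnth_mktuple (tnth_nth 0).
Qed.

Variables (n k : nat) (H : 'M[C]_n).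
Hypothesis pH : psdmx H.
Local Notation I := {ffun 'I_k -> 'I_n}.
Let P := spectralmx H.
Let d := spectral_diag H.
Let eH : H = P ^t* *m diag_mx d *m P.
Proof. by rewrite {1}(psdmx_spectral pH) invmx_unitary ?spectral_unitarymx. Qed.
Let PP : P *m P ^t* = 1%:M.
Proof. exact/unitarymxP/spectral_unitarymx. Qed.

(** In the eigenbasis of [H], an eigenvector for a nonzero eigenvalue has a nonzero coordinate at
    some injective map, so that eigenvalue is a product of [k] entries of [d] at distinct
    positions. *)
Lemma spec_le_compound :
  spec_le (\prod_(i < k) (eigenvalues H)`_i) (compound k H).
Proof.
have e0 := eigenvalues_psd_ge0 pH.
apply/spec_leP => a /eigenvalueP[v vH v0].
have [->|a0] := eqVneq a 0.
  by apply: prodr_ge0 => i _; apply: nth_eigenvalues_ge0.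
pose w := v *m compound k (P ^t*).
have wd : w *m diag_mx (prod_diag k d) = a *: w.
  rewrite /w -mulmxA -compound_mul_diag scalemxAl -vH -mulmxA compoundM.
  by rewrite {1}eH -!mulmxA PP mulmx1.
(* Being fixed by this projection makes the coordinates of [w] at non-injective maps vanish. *)
have w1 : w *m compound k 1%:M = w by rewrite -mulmxA compoundM mulmx1.
have w0 : w != 0.
  apply: contra_neq v0 => w0.
  have : a *: v = 0.
    by rewrite -vH {1}eH -!compoundM !mulmxA -/w w0 !mul0mx.
  by move/eqP; rewrite scaler_eq0 (negPf a0) => /eqP.
clearbody w; have [b wb] : exists b, w 0 b != 0.
  apply/existsP; apply: contra_neqT w0; rewrite negb_exists => /forallP w0.
  by apply/rowP => b; rewrite [RHS]mxE; apply/eqP; have := w0 b; rewrite negbK.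
have /injectiveP inj_b : injectiveb (enum_val b : I).
  apply: contraNT wb => nb; rewrite -w1 mxE big1 // => c _.
  by rewrite compound1_noninj ?mulr0.
have -> : a = \prod_i d 0 ((enum_val b : I) i).
  move/rowP/(_ b): wd; rewrite mul_mx_diag !mxE => /esym.
  by rewrite (mulrC a) => /(mulfI wb).
have [p pd] := spectral_diag_nth (psdmx_normal pH).
pose s := [seq (p ((enum_val b : I) i) : nat) | i <- enum 'I_k].
have us : uniq s.
  rewrite map_inj_uniq ?enum_uniq // => i j /val_inj/perm_inj.
  exact: inj_b.
have ss : size s = k by rewrite size_map size_enum_ord.
have := prod_top_le (fun i => nth_eigenvalues_ge0 i e0)
  (fun i j => @nth_eigenvalues_anti _ _ i j e0) us.
rewrite ss big_map big_enum /=.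
by under eq_bigr => i _ do rewrite -pd.
Qed.

(** The map [f] lists the positions of the [k] largest eigenvalues in [d]. Row [f] of [compound k P]
    is the eigenvector; it is nonzero because multiplying it back by the adjoint gives a nonzero
    diagonal entry of [compound 1%:M]. *)
Lemma eigenvalue_compound : (k <= n)%N ->
  eigenvalue (compound k H) (\prod_(i < k) (eigenvalues H)`_i).
Proof.
move=> kn; have [p pd] := spectral_diag_nth (psdmx_normal pH).
pose f : I := [ffun i => (p^-1)%g (widen_ord kn i)].
pose b := enum_rank f; have bf : enum_val b = f by apply: enum_rankK.
have inj_f : injective (enum_val b : I).
  move=> i j; rewrite bf !ffunE => /perm_inj/(congr1 val) /= ij.
  exact: val_inj.
have -> : \prod_(i < k) (eigenvalues H)`_i = prod_diag k d 0 b.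
  rewrite mxE bf; apply: eq_bigr => i _.
  by rewrite ffunE /d pd permKV.
apply/eigenvalueP; exists (row b (compound k P)).
  rewrite -row_mul compoundM {1}eH !mulmxA PP mul1mx compound_diag_mul.
  by rewrite mul_diag_mx; apply/rowP => c; rewrite !mxE.
apply/eqP => r0; have /eqP := @compound1_inj C _ _ b inj_f; apply.
have : (row b (compound k P) *m compound k (P ^t*)) 0 b = compound k 1%:M b b.
  by rewrite -row_mul compoundM PP [LHS]mxE.
by rewrite r0 mul0mx mxE => <-.
Qed.

End TopProduct.

(** * Log-majorization *)

Lemma sum_le_of_prod_le (R : realType) (x y : nat -> R) n :
  (forall i, 0 <= x i) -> (forall i, 0 <= y i) ->
  (forall i j, (i <= j)%N -> y j <= y i) ->
  (forall k, (k <= n)%N -> \prod_(j < k) y j <= \prod_(j < k) x j) ->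
  \sum_(j < n) y j <= \sum_(j < n) x j.
Proof.
move=> x0 y0 y_anti; elim: n => [|n IHn] yx; first by rewrite !big_ord0.
(* A vanishing last term is dropped; otherwise monotonicity makes every [y j] with [j <= n]
   positive, so that logarithms can be taken. *)
have [yn0|yn] := eqVneq (y n) 0.
  rewrite big_ord_recr /= yn0 addr0 big_ord_recr /=.
  apply: le_trans (IHn _) _; first by move=> k kn; apply/yx/leqW.
  by rewrite lerDl.
have y_gt0 j : (j <= n)%N -> 0 < y j.
  by move=> jn; apply: lt_le_trans (y_anti _ _ jn); rewrite lt_def yn y0.
have Py m : (m <= n.+1)%N -> 0 < \prod_(j < m) y j.
  by move=> mn; apply: prodr_gt0 => j _; apply/y_gt0; rewrite -ltnS (leq_trans _ mn).
have Px m : (m <= n.+1)%N -> 0 < \prod_(j < m) x j.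
  by move=> mn; apply: lt_le_trans (Py m mn) (yx m mn).
pose L m := ln (\prod_(j < m) x j) - ln (\prod_(j < m) y j).
have L0 m : (m <= n.+1)%N -> 0 <= L m.
  by move=> mn; rewrite subr_ge0 ler_ln ?posrE ?Px ?Py ?yx.
(* Abel summation as an induction: a constant [c] below all [y j] with [j < m] lets the step replace
   [c] by [y m], since every [L m] is nonnegative. *)
suff H m c : (m <= n.+1)%N -> 0 <= c -> (forall j, (j < m)%N -> c <= y j) ->
    c * L m <= \sum_(j < m) (x j - y j).
  have := H n.+1 0 (leqnn _) (lexx _) (fun j _ => y0 j).
  by rewrite mul0r sumrB subr_ge0.
elim: m c => [|m IHm] c mn c0 cy.
  by rewrite /L !big_ord0 subrr mulr0.
have ym := y_gt0 m mn.
have xm : 0 < x m.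
  have := Px m.+1 mn; rewrite big_ord_recr /= pmulr_rgt0 // Px //.
  exact: ltnW.
apply: (@le_trans _ _ (y m * L m.+1)).
  by apply: ler_wpM2r; [apply: L0 | apply: cy].
have IH : y m * L m <= \sum_(j < m) (x j - y j).
  apply: IHm => [||j jm]; [exact: ltnW | exact: y0 | exact/y_anti/ltnW].
have LE : L m.+1 = L m + ln (x m / y m).
  have Pxm := Px m (ltnW mn); have Pym := Py m (ltnW mn).
  by rewrite /L !big_ord_recr /= !lnM ?posrE ?invr_gt0 // lnV ?posrE //; ring.
rewrite LE mulrDr big_ord_recr /= lerD // -(ler_pdivlMl _ _ ym).
have -> : x m / y m = 1 + (x m / y m - 1) by ring.
apply: le_trans (le_ln1Dx _) _.
  by rewrite -subr_gt0 opprK subrK divr_gt0.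
by rewrite mulrBr mulVf ?gt_eqF // mulrC.
Qed.

Lemma powR_prod (R : realType) (I : Type) (s : seq I) (x : I -> R) (t : R) :
  (forall i, 0 <= x i) ->
  (\prod_(i <- s) x i) `^ t = \prod_(i <- s) (x i `^ t).
Proof.
move=> x0; elim: s => [|i s IHs]; first by rewrite !big_nil powR1.
by rewrite !big_cons powRM ?prodr_ge0 // IHs.
Qed.

Section Majorization.
Variable R : realType.
Local Notation C := R[i].

Lemma ge0_RRe (z : C) : 0 <= z -> z = (complex.Re z)%:C%C /\ 0 <= complex.Re z.
Proof. by case: z => x y; rewrite lecE => /andP[/= /eqP -> x0]. Qed.

Lemma prod_RRe (I : Type) (s : seq I) (z : I -> C) : (forall i, 0 <= z i) ->
  \prod_(i <- s) z i = (\prod_(i <- s) complex.Re (z i))%:C%C.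
Proof.
move=> z0; rewrite rmorph_prod; apply: eq_bigr => i _.
by case: (ge0_RRe (z0 i)).
Qed.

Lemma sum_le_of_prod_leC (x y : nat -> C) n :
  (forall i, 0 <= x i) -> (forall i, 0 <= y i) ->
  (forall i j, (i <= j)%N -> y j <= y i) ->
  (forall k, (0 < k <= n)%N -> \prod_(j < k) y j <= \prod_(j < k) x j) ->
  \sum_(j < n) y j <= \sum_(j < n) x j.
Proof.
move=> x0 y0 y_anti yx.
have sum_RRe (z : nat -> C) : (forall i, 0 <= z i) ->
    \sum_(j < n) z j = (\sum_(j < n) complex.Re (z j))%:C%C.
  move=> z0; rewrite rmorph_sum; apply: eq_bigr => j _.
  by case: (ge0_RRe (z0 j)).
rewrite (sum_RRe x) // (sum_RRe y) // lecR.
apply: (@sum_le_of_prod_le R (fun i => complex.Re (x i)) (fun i => complex.Re (y i)) n).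
- by move=> i; case: (ge0_RRe (x0 i)).
- by move=> i; case: (ge0_RRe (y0 i)).
- by move=> i j /y_anti; rewrite lecE => /andP[].
move=> k kn; have [->|k0] := posnP k; first by rewrite !big_ord0.
have /yx : (0 < k <= n)%N by rewrite k0.
rewrite (prod_RRe _ (fun j : 'I_k => x0 j)).
by rewrite (prod_RRe _ (fun j : 'I_k => y0 j)) lecR.
Qed.

Lemma det_psdpow n (A : 'M[C]_n) t : psdmx A ->
  \det (psdpow A t) = ((complex.Re (\det A)) `^ t)%:C%C.
Proof.
move=> pA; have d0 i := psdmx_spectral_diag_ge0 i pA.
have detE (D : 'rV[C]_n) :
    \det (invmx (spectralmx A) *m diag_mx D *m spectralmx A) = \prod_i D 0 i.
  rewrite -mulmxA det_mulmx mulrC -det_mulmx mulmxK ?spectral_unit //.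
  exact: det_diag.
rewrite -psdpowE {1}/mxpow /mxfun detE {2}(psdmx_spectral pA) detE.
rewrite (prod_RRe _ d0) /= powR_prod; last by move=> i; case: (ge0_RRe (d0 i)).
by rewrite rmorph_prod; apply: eq_bigr => i _; rewrite mxE.
Qed.

Lemma psdmx_compound n k (A : 'M[C]_n) : psdmx A -> psdmx (compound k A).
Proof.
move=> pA; have <- : psdpow A 2^-1 *m psdpow A 2^-1 = A.
  by rewrite -[2^-1]mul1r psdpow_half // psdpow1.
by rewrite -compoundM -{2}(psdpow_adj A) -compound_adj; apply: psdmx_gram.
Qed.

(** [V] need not be invertible, since [compound] sends the identity to a projection. The two sides
    are compared on the range of this projection; on its complement both vanish because [0 < t]. *)
Lemma psdpow_compound n k (A : 'M[C]_n) t : psdmx A -> 0 < t ->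
  psdpow (compound k A) t = compound k (psdpow A t).
Proof.
move=> pA t0; have pK := psdmx_compound k pA.
have d0 i := psdmx_spectral_diag_ge0 i pA.
set P := spectralmx A; have uP : P \in unitmx by apply: spectral_unit.
pose V := compound k (invmx P).
have KV : compound k A *m V = V *m diag_mx (prod_diag k (spectral_diag A)).
  rewrite compoundM -compound_mul_diag; congr compound.
  by rewrite {1}(psdmx_spectral pA) mulmxK.
have tV : psdpow (compound k A) t *m V = compound k (psdpow A t) *m V.
  rewrite -[in LHS]psdpowE (intertwine_diag _ (psdmx_normal pK) KV).
  rewrite compoundM -psdpowE /mxpow /mxfun mulmxK // compound_mul_diag.
  congr (_ *m diag_mx _); apply/rowP => b; rewrite !mxE.
  rewrite (prod_RRe _ (fun i => d0 _)) /= powR_prod; last first.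
    by move=> i; case: (ge0_RRe (d0 ((enum_val b : {ffun _ -> _}) i))).
  by rewrite rmorph_prod; apply: eq_bigr => i _; rewrite mxE.
have K1 : psdpow (compound k A) t *m compound k 1%:M = psdpow (compound k A) t.
  have : psdpow (compound k A) t *m (1%:M - compound k 1%:M) = 0.
    apply: psdpow_mul0 pK (lt0r_neq0 t0) _.
    by rewrite mulmxBr compoundM !mulmx1 subrr.
  by rewrite mulmxBr mulmx1 => /eqP; rewrite subr_eq0 => /eqP.
have := congr1 (fun Z => Z *m compound k P) tV.
by rewrite -!mulmxA compoundM mulVmx // K1 compoundM mulmx1.
Qed.

Lemma eigenvalues_sandwich n (A B : 'M[C]_n) a b : 0 <= b ->
  eigenvalues (psdpow A a *m psdpow B b) =
  eigenvalues (psdpow B (b / 2) *m psdpow A a *m psdpow B (b / 2)).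
Proof.
move=> b0; rewrite /eigenvalues -(psdpow_half B b0) mulmxA.
by rewrite char_poly_mulC mulmxA.
Qed.

Lemma psdmx_sandwich n (A B : 'M[C]_n) a b :
  psdmx (psdpow B b *m psdpow A a *m psdpow B b).
Proof. by rewrite -{1}(psdpow_adj B); apply: psdmx_congr; apply: psdpow_psd. Qed.

(** The products are first replaced by positive semidefinite matrices with the same eigenvalues, as
    the lemmas on [compound] require; cyclicity then restores the form of [spec_le_psdpow_conj]. *)
Lemma prod_eigenvalues_le n k (A B : 'M[C]_n) (r s : R) : psdmx A -> psdmx B ->
  1 <= s -> 0 <= r -> s <= 2 \/ r * (s - 2) <= s -> (k <= n)%N ->
  \prod_(j < k) (eigenvalues (psdpow A r *m
     psdpow (psdpow A 2^-1 *m B *m psdpow A 2^-1) s))`_j <=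
  \prod_(j < k) (eigenvalues (psdpow A (r + s) *m psdpow B s))`_j.
Proof.
move=> pA pB s1 r0 sr kn; have s0 : 0 < s by apply: lt_le_trans s1.
set D := psdpow A 2^-1 *m B *m psdpow A 2^-1.
have pD : psdmx D by rewrite /D -{1}(psdpow_adj A); apply: psdmx_congr.
rewrite (eigenvalues_sandwich A D r (ltW s0)).
rewrite (eigenvalues_sandwich A B (r + s) (ltW s0)).
set X := psdpow B (s / 2) *m _ *m _; set Y := psdpow D (s / 2) *m _ *m _.
have pX : psdmx X by apply: psdmx_sandwich.
have pY : psdmx Y by apply: psdmx_sandwich.
have prod_ge0 (H : 'M[C]_n) : psdmx H -> 0 <= \prod_(j < k) (eigenvalues H)`_j.
  by move=> pH; apply: prodr_ge0 => j _; apply/nth_eigenvalues_ge0/eigenvalues_psd_ge0.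
suff le_xy (x y : C) : 0 <= x -> 0 <= y -> spec_le x (compound k X) ->
    eigenvalue (compound k Y) y -> y <= x.
  exact: (le_xy _ _ (prod_ge0 X pX) (prod_ge0 Y pY) (spec_le_compound k pX)
            (eigenvalue_compound pY kn)).
move=> x0 y0 Xx Yy; have [->//|yn0] := eqVneq y 0.
have {}Xx : spec_le x (psdpow (compound k A) (r + s) *m psdpow (compound k B) s).
  rewrite (psdpow_compound k pA (ltr_wpDl r0 s0)) (psdpow_compound k pB s0) compoundM.
  rewrite -(psdpow_half B (ltW s0)) mulmxA.
  by rewrite -compoundM; apply: (spec_le_mulC x0); rewrite compoundM mulmxA.
have {}Yy : eigenvalue (psdpow (compound k A) r *m psdpow (compound k D) s) y.
  have -> : psdpow (compound k A) r *m psdpow (compound k D) s =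
            compound k (psdpow A r *m psdpow D s).
    rewrite (psdpow_compound _ pD s0) -compoundM.
    (* At exponent 0 the power of [compound k A] is the identity and not [compound k 1%:M], hence
       the separate case. *)
    move: r0; rewrite le_eqVlt => /predU1P[<-|r_gt0].
      by rewrite !psdpow0 mul1mx compoundM mul1mx.
    by rewrite psdpow_compound.
  rewrite -(psdpow_half D (ltW s0)) mulmxA -compoundM.
  by apply: (eigenvalue_mulC yn0); rewrite compoundM mulmxA.
have DE : compound k D =
    psdpow (compound k A) 2^-1 *m compound k B *m psdpow (compound k A) 2^-1.
  by rewrite psdpow_compound ?invr_gt0 // !compoundM.
have [ex xr0] := ge0_RRe x0; have [ey yr0] := ge0_RRe y0.
(* [spec_le_psdpow_conj] requires a positive bound while [x] may be 0, hence the slack [e]. *)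
rewrite ex ey lecR; apply/ler_addgt0Pr => e e0.
have xe0 : 0 < complex.Re x + e by rewrite ltr_wpDl.
have Xxe : spec_le (complex.Re x + e)%:C%C
    (psdpow (compound k A) (r + s) *m psdpow (compound k B) s).
  apply/spec_leP => a /(elimT (spec_leP _ _) Xx) ax; apply: le_trans ax _.
  by rewrite {1}ex lecR lerDl ltW.
have := spec_le_psdpow_conj (psdmx_compound k pA) (psdmx_compound k pB)
  s1 r0 sr xe0 Xxe.
rewrite -DE => /spec_leP/(_ y Yy).
by rewrite {1}ey lecR.
Qed.

Lemma det_mul_psdpow n (A B : 'M[C]_n) (r s : R) : psdmx A -> psdmx B ->
  1 <= s -> 0 <= r ->
  \det (psdpow A (r + s) *m psdpow B s) =
  \det (psdpow A r *m psdpow (psdpow A 2^-1 *m B *m psdpow A 2^-1) s).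
Proof.
move=> pA pB s1 r0; have s0 : 0 < s by apply: lt_le_trans s1.
set D := psdpow A 2^-1 *m B *m psdpow A 2^-1.
have pD : psdmx D by rewrite /D -{1}(psdpow_adj A); apply: psdmx_congr.
have detD : \det D = \det A * \det B.
  rewrite /D !det_mulmx mulrAC -det_mulmx -[2^-1]mul1r psdpow_half //.
  by rewrite psdpow1.
rewrite !det_mulmx !det_psdpow // detD -!rmorphM.
have det0 (M : 'M[C]_n) : psdmx M -> 0 <= \det M.
  move=> pM; rewrite (psdmx_spectral pM) -mulmxA det_mulmx mulrC -det_mulmx.
  rewrite mulmxK ?spectral_unit // det_diag prodr_ge0 // => i _.
  exact: psdmx_spectral_diag_ge0.
have [eA a0] := ge0_RRe (det0 _ pA); have [eB b0] := ge0_RRe (det0 _ pB).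
rewrite eA eB -rmorphM /= powRM // powRD ?mulrA //.
by rewrite gt_eqF // ltr_wpDl.
Qed.

Lemma log_majorizes_psdpow n (A B : 'M[C]_n) (r s : R) : psdmx A -> psdmx B ->
  1 <= s -> 0 <= r -> s <= 2 \/ r * (s - 2) <= s ->
  log_majorizes (psdpow A (r + s) *m psdpow B s)
    (psdpow A r *m psdpow (psdpow A 2^-1 *m B *m psdpow A 2^-1) s).
Proof.
move=> pA pB s1 r0 sr; split; last exact: det_mul_psdpow.
by move=> k /andP[_ kn]; apply: prod_eigenvalues_le => //; apply: ltnW.
Qed.

Lemma det_eigenvalues n (X : 'M[C]_n) : \det X = \prod_(j < n) (eigenvalues X)`_j.
Proof.
have := char_poly_det X; rewrite char_poly_eigenvalues coef0_prod_XsubC.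
rewrite size_eigenvalues => /(mulfI _) <-; last by rewrite signr_eq0.
by rewrite (big_nth 0) size_eigenvalues big_mkord.
Qed.

Lemma tr_eigenvalues n (X : 'M[C]_n) : \tr X = \sum_(j < n) (eigenvalues X)`_j.
Proof.
have [n0|n0] := posnP n.
  by move: X; rewrite n0 => X; rewrite /mxtrace !big_ord0.
have := @coefPn_prod_XsubC _ (eigenvalues X).
rewrite size_eigenvalues -char_poly_eigenvalues char_poly_trace // -lt0n.
move=> /(_ n0)/oppr_inj ->.
by rewrite (big_nth 0) size_eigenvalues big_mkord.
Qed.

Lemma log_majorizes_tr n (X Y : 'M[C]_n) :
  {in eigenvalues X, forall z, 0 <= z} -> {in eigenvalues Y, forall z, 0 <= z} ->
  log_majorizes X Y -> \tr Y <= \tr X.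
Proof.
move=> X0 Y0 [XY dXY]; rewrite !tr_eigenvalues.
apply: (@sum_le_of_prod_leC (fun j => (eigenvalues X)`_j)
  (fun j => (eigenvalues Y)`_j)) => [j|j|i j|k /andP[k0 kn]].
- exact: nth_eigenvalues_ge0.
- exact: nth_eigenvalues_ge0.
- exact: nth_eigenvalues_anti.
(* At [k = n] the comparison of products is the equality of determinants. *)
move: kn; rewrite leq_eqVlt => /predU1P[->|kn]; last by apply: XY; rewrite k0.
have pYX := etrans (esym (det_eigenvalues Y)) (etrans (esym dXY) (det_eigenvalues X)).
exact: (eq_ind _ (fun z => _ <= z) (lexx _) _ pYX).
Qed.

End Majorization.

(** * Failure outside the parameter range *)

(** The quadratic form of [M] is evaluated at [e - c *: u], the component of the basis vector [e]
    orthogonal to [u]. *)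
Lemma psdmx_diag_entry_ge (C : numClosedFieldType) n (M : 'M[C]_n) (u : 'cV[C]_n)
    (l N : C) i :
  psdmx M -> M *m u = l *: u -> l \is Num.real -> 0 < N -> (u ^t* *m u) 0 0 = N ->
  l * (u i 0 * (u i 0)^*) / N <= M i i.
Proof.
move=> pM Mu /conj_Creal lr N0 uu; set z := u i 0; pose c := z^* / N.
have cr : c^* = z / N.
  rewrite /c rmorphM /= conjCK fmorphV; congr (_ / _).
  exact/conj_Creal/ger0_real/ltW.
have uM : u ^t* *m M = l *: u ^t*.
  by rewrite -(psdmx_adj pM) -adjmxM Mu linearZ map_mxZ /= lr.
pose e : 'cV[C]_n := delta_mx i 0.
have eT : e ^t* = delta_mx 0 i.
  by apply/matrixP => a b; rewrite !mxE [LHS]rmorph_nat andbC.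
have [_ /(_ (e - c *: u))] := pM.
have -> : (e - c *: u) ^t* = delta_mx 0 i - c^* *: u ^t*.
  by rewrite adjmxB eT linearZ map_mxZ.
rewrite mulmxBl mulmxBr mulmxBl -!scalemxAl -!scalemxAr mulmxBl -!scalemxAl uM.
rewrite -!scalemxAl -(mulmxA _ M u) Mu -scalemxAr.
have Eee : ((delta_mx 0 i : 'rV[C]_n) *m M *m e) 0 0 = M i i.
  by rewrite -rowE -colE !mxE.
have Eue : (u ^t* *m e) 0 0 = z^* by rewrite -colE !mxE.
have Eeu : ((delta_mx 0 i : 'rV[C]_n) *m u) 0 0 = z by rewrite -rowE mxE.
have entry (a a1 b b1 : 'M[C]_1) (k k1 : C) :
    (a - k *: a1 - k1 *: (b - k *: b1)) 0 0 =
    a 0 0 - k * a1 0 0 - k1 * (b 0 0 - k * b1 0 0) by rewrite !mxE.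
have scal (a : C) (X : 'M[C]_1) : (a *: X) 0 0 = a * X 0 0 by rewrite mxE.
rewrite {}entry Eee !scal Eue Eeu uu cr /c.
have fieldE (m w w' : C) :
    m - w / N * (l * w') - w' / N * (l * w - w / N * (l * N)) = m - l * (w * w') / N.
  by field; apply: lt0r_neq0.
by rewrite fieldE subr_ge0.
Qed.

(** * Powers of real matrices and the three-dimensional example *)

Section RealMatrices.
Variable R : realType.
Local Notation C := R[i].
Local Notation rc := (map_mx (real_complex R)).

Lemma real_complex_real (c : R) : (c%:C%C : C) \is Num.real.
Proof. by rewrite complex_real. Qed.

Lemma adjmx_real m n (M : 'M[R]_(m, n)) : (rc M) ^t* = rc M^T.
Proof.
apply/matrixP => i j; rewrite !mxE; apply: conj_Creal.
exact: real_complex_real.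
Qed.

Lemma psdmx_diag_real n (d : 'rV[R]_n) : (forall i, 0 <= d 0 i) ->
  psdmx (rc (diag_mx d)).
Proof.
move=> d0; apply: psdmxP; first by rewrite adjmx_real tr_diag_mx.
move=> x; rewrite map_diag_mx mul_mx_diag mxE; apply: sumr_ge0 => i _.
rewrite !mxE mulrAC mulrC mulr_ge0 ?ler0c //.
by rewrite mulrC mul_conjC_ge0.
Qed.

Lemma psdpow_diag_real n (d : 'rV[R]_n) t : (forall i, 0 <= d 0 i) ->
  psdpow (rc (diag_mx d)) t = rc (diag_mx (map_mx (fun x => x `^ t) d)).
Proof.
move=> d0; rewrite !map_diag_mx psdpow_diag => [|i]; last by rewrite mxE ler0c.
by congr diag_mx; apply/rowP => i; rewrite !mxE.
Qed.

(** The columns of [V] are orthogonal, so [B] multiplies them by [e_j g_j]. Splitting off one factor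
    [B] leaves [B^(s - 1)] acting on [V]. *)
Lemma psdpow_gram_real m n (V : 'M[R]_(m, n)) (e g : 'rV[R]_n) s :
  (forall j, 0 <= e 0 j) -> V^T *m V = diag_mx g -> 1 <= s ->
  psdpow (rc (V *m diag_mx e *m V^T)) s =
  rc (V *m diag_mx (\row_j ((e 0 j * g 0 j) `^ (s - 1) * e 0 j)) *m V^T).
Proof.
move=> e0 VV s1; set B := rc _.
have pB : psdmx B.
  rewrite /B !map_mxM -{1}[V]trmxK -adjmx_real.
  exact/psdmx_congr/psdmx_diag_real.
pose d : 'rV[C]_n := map_mx (real_complex R) (\row_j (e 0 j * g 0 j)).
have BV : B *m rc V = rc V *m diag_mx d.
  rewrite /B -map_mxM -!mulmxA VV mulmx_diag map_mxM map_diag_mx.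
  by congr (_ *m diag_mx _); apply/rowP => j; rewrite !mxE.
have s10 : 0 <= s - 1 by rewrite subr_ge0.
have -> : psdpow B s = psdpow B (s - 1) *m B.
  by rewrite -{3}(psdpow1 pB) psdpowD // subrK.
have tV : psdpow B (s - 1) *m rc V =
    rc (V *m diag_mx (\row_j (e 0 j * g 0 j) `^ (s - 1))).
  rewrite -psdpowE (intertwine_diag _ (psdmx_normal pB) BV) map_mxM map_diag_mx.
  by congr (_ *m diag_mx _); apply/rowP => j; rewrite !mxE.
rewrite {2}/B -mulmxA map_mxM mulmxA tV -map_mxM !mulmxA.
rewrite -(mulmxA V _ (diag_mx e)) mulmx_diag.
by congr (map_mx _ (_ *m diag_mx _ *m _)); apply/rowP => j; rewrite !mxE.
Qed.

Lemma psdpow_eigenvector n (M : 'M[C]_n) (u : 'cV[C]_n) (l t : R) :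
  psdmx M -> M *m u = l%:C%C *: u -> psdpow M t *m u = (l `^ t)%:C%C *: u.
Proof.
move=> pM Mu; have Mud : M *m u = u *m diag_mx (const_mx l%:C%C : 'rV_1).
  by rewrite diag_const_mx mul_mx_scalar.
rewrite -psdpowE (intertwine_diag _ (psdmx_normal pM) Mud) map_const_mx.
by rewrite diag_const_mx mul_mx_scalar.
Qed.

Lemma mxtrace_diag_mul (F : comPzRingType) n (d : 'rV[F]_n) (M : 'M[F]_n) :
  \tr (diag_mx d *m M) = \sum_i d 0 i * M i i.
Proof. by rewrite mul_diag_mx; apply: eq_bigr => i _; rewrite mxE. Qed.

Lemma diag_entry_le_tr n (d : 'rV[R]_n) (M : 'M[C]_n) i :
  (forall i, 0 <= d 0 i) -> d 0 i = 1 -> psdmx M ->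
  M i i <= \tr (rc (diag_mx d) *m M).
Proof.
move=> d0 di pM; rewrite map_diag_mx mxtrace_diag_mul (bigD1 i) //= mxE di mul1r.
rewrite lerDl sumr_ge0 // => j _; rewrite mxE mulr_ge0 ?ler0c //.
have [_ /(_ (delta_mx j 0))] := pM.
suff -> : ((delta_mx j 0 : 'cV[C]_n) ^t*) = delta_mx 0 j.
  by rewrite -rowE -colE !mxE.
by apply/matrixP => a b; rewrite !mxE [LHS]rmorph_nat andbC.
Qed.

(* [A = diag(1, b, 0)]; the upper left block of [A^(1/2) B A^(1/2)] is
   [v v^T + mu v' v'^T] with [v = (mu sqrt b, 1)] and [v' = (1, - mu sqrt b)], and
   [B] has rank 2. The trace of [A^(r+s) B^s] is of order [mu^s + b^r], the other
   one at least [mu^2 b], so that [mu = b^g] with [1 < g (s - 2)] and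
   [2 g + 1 < r] is a counterexample for small [b]. *)
Section Example.
Variables (r s mu b : R).
Hypotheses (r0 : 0 < r) (s2 : 2 < s) (mu0 : 0 < mu) (mu1 : mu <= 1).
Hypotheses (b0 : 0 < b) (b1 : b <= 1).

(** [x] and [y sqrt b] form the first row of the prescribed block, and [q] completes its lower right
    entry. The third coordinate, killed by [A], makes the columns of [V] orthogonal, so that the
    powers of [B] are explicit. *)
Let x := mu + mu ^+ 2 * b.
Let y := mu - mu ^+ 2.
Let q := (1 + mu ^+ 2 * b) ^+ 2 / (b * (1 + mu * b)).

Let a : 'rV[R]_3 := \row_i [:: 1; b; 0]`_i.
Let V : 'M[R]_(3, 2) :=
  \matrix_(i, j) (if j == 0 then [:: x; y; - y]`_i else [:: 0; 1; 1]`_i).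
Let e : 'rV[R]_2 := \row_j [:: x^-1; q]`_j.
Let g : 'rV[R]_2 := \row_j [:: x ^+ 2 + 2 * y ^+ 2; 2]`_j.
Let u : 'cV[R]_3 := \col_i [:: mu * Num.sqrt b; 1; 0]`_i.

Definition counterA : 'M[C]_3 := rc (diag_mx a).
Definition counterB : 'M[C]_3 := rc (V *m diag_mx e *m V^T).

Let x0 : 0 < x.
Proof. by rewrite addr_gt0 // mulr_gt0 // exprn_gt0. Qed.

Let q0 : 0 < q.
Proof.
by rewrite divr_gt0 ?exprn_gt0 ?mulr_gt0 // addr_gt0 // mulr_gt0 // exprn_gt0.
Qed.

Let a0 i : 0 <= a 0 i.
Proof. by rewrite mxE; case: i => [[|[|[|]]]] //= _; rewrite ltW. Qed.

Let e0 j : 0 <= e 0 j.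
Proof. by rewrite mxE; case: j => [[|[|]]] //= _; rewrite ltW // invr_gt0. Qed.

Let VV : V^T *m V = diag_mx g.
Proof.
apply/matrixP => i j; rewrite !mxE !big_ord_recl big_ord0 !mxE /=.
by case: i j => [[|[|]]] //= ? [[|[|]]] //= ?; ring.
Qed.

Lemma counterA_psd : psdmx counterA. Proof. exact: psdmx_diag_real. Qed.

Lemma counterB_psd : psdmx counterB.
Proof.
rewrite /counterB !map_mxM -{1}[V]trmxK -adjmx_real.
exact/psdmx_congr/psdmx_diag_real.
Qed.

Let beta := Num.sqrt b.
Let beta2 : beta ^+ 2 = b. Proof. by rewrite sqr_sqrtr // ltW. Qed.
Let lam := 1 + mu ^+ 2 * b.
Let lam1 : 1 <= lam. Proof. by rewrite lerDl mulr_ge0 ?exprn_ge0 // ltW. Qed.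
Let mub : 0 < 1 + mu * b. Proof. by rewrite addr_gt0 // mulr_gt0. Qed.
Let S : 'rV[R]_3 := \row_i [:: 1; beta; 0]`_i.

Lemma counterA_half : psdpow counterA 2^-1 = rc (diag_mx S).
Proof.
rewrite psdpow_diag_real //; congr (map_mx _ (diag_mx _)); apply/rowP => i.
rewrite !mxE; case: i => [[|[|[|]]]] //= _; first by rewrite powR1.
  by rewrite powR12_sqrt // ltW.
by rewrite powR0 // invr_eq0 pnatr_eq0.
Qed.

Lemma counter_eigen :
  diag_mx S *m (V *m diag_mx e *m V^T) *m diag_mx S *m u = lam *: u.
Proof.
have xE : x = mu * (1 + mu * b) by rewrite /x; ring.
have th_lam : x * (mu * beta) + y * beta = mu * beta * lam.
  by rewrite /x /y /lam; ring.
rewrite -!mulmxA.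
have -> : diag_mx S *m u = \col_i [:: mu * beta; beta; 0]`_i.
  rewrite mul_diag_mx; apply/colP => i; rewrite !mxE.
  by case: i => [[|[|[|]]]] //= _; rewrite ?mul1r ?mulr1 ?mulr0.
have -> : V^T *m \col_(i < 3) [:: mu * beta; beta; 0]`_i =
          \col_i [:: mu * beta * lam; beta]`_i.
  apply/colP => i; rewrite !mxE !big_ord_recl big_ord0 !mxE /=.
  by case: i => [[|[|]]] //= _; rewrite -?th_lam; ring.
have -> : diag_mx e *m \col_i [:: mu * beta * lam; beta]`_i =
          \col_i [:: mu * beta * lam / x; q * beta]`_i.
  rewrite mul_diag_mx; apply/colP => i; rewrite !mxE.
  by case: i => [[|[|]]] //= _; rewrite mulrC.
have -> : V *m \col_i [:: mu * beta * lam / x; q * beta]`_i = \col_i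
    [:: mu * beta * lam; y * (mu * beta * lam / x) + q * beta;
        - y * (mu * beta * lam / x) + q * beta]`_i.
  apply/colP => i; rewrite !mxE !big_ord_recl big_ord0 !mxE /=.
  case: i => [[|[|[|]]]] //= _; rewrite ?mul0r ?mul1r ?addr0 //.
  by rewrite mulrC divfK // gt_eqF.
rewrite mul_diag_mx; apply/colP => i; rewrite !mxE.
case: i => [[|[|[|]]]] //= _; rewrite ?mul0r ?mulr0 ?mul1r ?mulr1 // ?(mulrC lam) //.
have lamE : lam = 1 + mu ^+ 2 * beta ^+ 2 by rewrite beta2.
have mub' : 1 + mu * beta ^+ 2 != 0 by rewrite beta2 gt_eqF.
have beta0 : beta != 0 by rewrite gt_eqF // sqrtr_gt0.
rewrite xE /q -/lam -beta2 /y lamE; field.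
by rewrite mub' beta0 gt_eqF.
Qed.

(** [u] is an eigenvector of [D^s] for [lam^s], so the first diagonal entry of [D^s] is at least
    [lam^s mu^2 b / lam], where [1 <= lam]. That entry has weight 1 in the trace. *)
Lemma counter_lower : (mu ^+ 2 * b)%:C%C <=
  \tr (psdpow counterA r *m
       psdpow (psdpow counterA 2^-1 *m counterB *m psdpow counterA 2^-1) s).
Proof.
set D := psdpow counterA 2^-1 *m counterB *m _.
have DE : D = rc (diag_mx S *m (V *m diag_mx e *m V^T) *m diag_mx S).
  by rewrite /D counterA_half -!map_mxM.
have pD : psdmx D.
  by rewrite /D -{1}(psdpow_adj counterA); apply/psdmx_congr/counterB_psd.
have Du : D *m rc u = lam%:C%C *: rc u.
  by rewrite DE -map_mxM counter_eigen map_mxZ.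
rewrite psdpow_diag_real //.
apply: le_trans (@diag_entry_le_tr _ _ _ 0 _ _ (psdpow_psd D s)); last first.
- by rewrite !mxE /= powR1.
- by move=> i; rewrite mxE powR_ge0.
have lam0 : 0 < lam by apply: lt_le_trans lam1.
have uu : ((rc u) ^t* *m rc u) 0 0 = lam%:C%C.
  rewrite adjmx_real -map_mxM mxE; congr (_%:C%C).
  rewrite !mxE !big_ord_recl big_ord0 !mxE /= -/beta /lam -beta2.
  by ring.
have lamC : 0 < lam%:C%C :> C by rewrite ltcR.
have := psdmx_diag_entry_ge 0 (psdpow_psd D s) (psdpow_eigenvector s pD Du)
  (real_complex_real _) lamC uu.
apply: le_trans.
have -> : rc u 0 0 = (mu * beta)%:C%C by rewrite !mxE.
rewrite (conj_Creal (real_complex_real _)) -!rmorphM -fmorphV -rmorphM lecR.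
have -> : mu * beta * (mu * beta) = mu ^+ 2 * b by rewrite -beta2; ring.
rewrite [leRHS]mulrAC ler_peMl //; first by rewrite mulr_ge0 ?exprn_ge0 // ltW.
rewrite ler_pdivlMr // mul1r le1r_powR //.
by apply: ltW; apply: lt_trans s2; rewrite ltr1n.
Qed.

Let f (j : 'I_2) := (e 0 j * g 0 j) `^ (s - 1) * e 0 j.

Lemma counter_upper :
  \tr (psdpow counterA (r + s) *m psdpow counterB s) =
  (x ^+ 2 * f 0 + b `^ (r + s) * (y ^+ 2 * f 0 + f 1))%:C%C.
Proof.
have s1 : 1 <= s by apply: ltW; apply: lt_trans s2; rewrite ltr1n.
have rs0 : r + s != 0 by rewrite gt_eqF // addr_gt0 //; apply: lt_trans s2.
rewrite psdpow_diag_real // (psdpow_gram_real e0 VV s1) -map_mxM trace_map_mx.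
congr (_%:C%C); rewrite mxtrace_diag_mul !big_ord_recl big_ord0 !mxE /=.
rewrite !big_ord_recl !big_ord0 !mul_mx_diag !mxE /= powR1 powR0 //.
rewrite /f !mxE /=; move: (_ `^ (s - 1)) (_ `^ (s - 1)) => w1 w2.
have := mulfV (lt0r_neq0 x0); move: x^-1 => xV xxV; ring: xxV.
Qed.

Lemma mul_powR_le (p v z : R) : 0 <= p <= z -> 0 <= v <= z ->
  p * v `^ (s - 1) <= z `^ s.
Proof.
move=> /andP[p0 pz] /andP[v0 vz]; have z0 := le_trans p0 pz.
have s0 : 0 < s by apply: lt_trans s2.
rewrite -(mulr_powRB1 z0 s0) ler_pM ?powR_ge0 //.
apply: ge0_ler_powR; rewrite ?nnegrE // subr_ge0.
by apply: ltW; apply: lt_trans s2; rewrite ltr1n.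
Qed.

(** [x], [y] and [w] are at most of order [mu] and [q] at most of order [1 / b], so [b^(r + s) q^s]
    is of order [b^r]. The constant 4 comes from [w <= 4 mu] and [2 q <= 4 / b]. *)
Lemma counter_upper_le :
  x ^+ 2 * f 0 + b `^ (r + s) * (y ^+ 2 * f 0 + f 1) <=
  4 `^ s * (2 * mu `^ s + b `^ r).
Proof.
have s0 : 0 < s by apply: lt_trans s2.
have rs0 : 0 <= r + s by rewrite addr_ge0 // ltW.
pose w := x^-1 * (x ^+ 2 + 2 * y ^+ 2).
have f0E : f 0 = w `^ (s - 1) / x by rewrite /f !mxE.
have f1E : f 1 = (q * 2) `^ (s - 1) * q by rewrite /f !mxE.
have y0 : 0 <= y by rewrite subr_ge0 expr2 ler_piMl // ltW.
have ymu : y <= mu by rewrite lerBlDr lerDl exprn_ge0 // ltW.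
have mux : mu <= x by rewrite lerDl mulr_ge0 ?exprn_ge0 // ltW.
have x2mu : x <= 2 * mu.
  have : mu ^+ 2 * b <= mu * 1.
    rewrite expr2 -mulrA ler_pM2l // -[leRHS]mulr1.
    by apply: ler_pM => //; apply: ltW.
  by rewrite /x; lra.
have yx : 0 <= y ^+ 2 / x <= mu.
  rewrite divr_ge0 ?exprn_ge0 ?(ltW x0) //= ler_pdivrMr // expr2.
  by apply: ler_pM => //; apply: le_trans mux.
have wE : w = x + 2 * (y ^+ 2 / x) by rewrite /w; field; apply: lt0r_neq0.
have w4 : 0 <= w <= 4 * mu by rewrite wE; lra.
have mu4 : (4 * mu) `^ s = 4 `^ s * mu `^ s by rewrite powRM // ltW.
have t1 : x ^+ 2 * f 0 <= 4 `^ s * mu `^ s.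
  have -> : x ^+ 2 * f 0 = x * w `^ (s - 1).
    by rewrite f0E; field; apply: lt0r_neq0.
  by rewrite -mu4; apply: mul_powR_le => //; lra.
have t2 : y ^+ 2 * f 0 <= 4 `^ s * mu `^ s.
  rewrite f0E mulrCA mulrC -mu4; apply: mul_powR_le => //; lra.
have b_le1 : b `^ (r + s) <= 1.
  by rewrite -[leRHS](powRr0 b); apply: ger_powR => //; rewrite b0.
have q2 : 0 <= q <= 2 / b.
  rewrite (ltW q0) /= /q -/lam invfM mulrA ler_pdivrMr // [leRHS]mulrAC.
  rewrite ler_pM2r ?invr_gt0 //.
  have l2 : lam <= 1 + mu * b.
    by rewrite lerD2l ler_wpM2r ?(ltW b0) // expr2 ler_piMl // ltW.
  have l3 : 1 + mu * b <= 2.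
    have : mu * b <= 1 * 1 by apply: ler_pM => //; apply: ltW.
    lra.
  by rewrite expr2 ler_pM // ?(le_trans l2) // (le_trans ler01).
have t3 : b `^ (r + s) * f 1 <= 4 `^ s * b `^ r.
  have : f 1 <= (4 / b) `^ s.
    rewrite f1E mulrC; apply: mul_powR_le; first by move: q2; lra.
    by move: q2; lra.
  move=> /(ler_wpM2l (powR_ge0 b (r + s))).
  have bV : 0 <= b^-1 by rewrite invr_ge0 ltW.
  have bs0 : b `^ s != 0 by rewrite gt_eqF // powR_gt0.
  have -> : (4 / b) `^ s = 4 `^ s / b `^ s.
    rewrite powRM //; congr (_ * _).
    by rewrite -powR_inv1 ?(ltW b0) // -powRrM mulN1r powRN.
  rewrite powRD; last by rewrite (gt_eqF b0) implybT.
  by move=> H; apply: le_trans H _; rewrite mulrC -mulrA (mulrC (b `^ r)) mulKf.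
rewrite mulrDr addrA mulrDr (mulrCA _ 2) mulr2n mulrDl mul1r.
apply: lerD t3; apply: lerD t1 _; apply: le_trans t2.
by rewrite ler_piMl // mulr_ge0 ?exprn_ge0 // f0E divr_ge0 ?powR_ge0 // ltW.
Qed.

Lemma counter_tr_le :
  \tr (psdpow counterA (r + s) *m psdpow counterB s) <=
  (4 `^ s * (2 * mu `^ s + b `^ r))%:C%C.
Proof. by rewrite counter_upper lecR counter_upper_le. Qed.

End Example.

Lemma tr_counterexample (r s : R) : 2 < s -> s / (s - 2) < r ->
  exists A B : 'M[C]_3, [/\ psdmx A, psdmx B &
    \tr (psdpow A (r + s) *m psdpow B s) <
    \tr (psdpow A r *m psdpow (psdpow A 2^-1 *m B *m psdpow A 2^-1) s)].
Proof.
move=> s2 sr; have s20 : 0 < s - 2 by rewrite subr_gt0.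
have r0 : 0 < r by apply: lt_trans sr; rewrite divr_gt0 //; apply: lt_trans s2.
have sE : s / (s - 2) = 1 + 2 / (s - 2) by field; apply: lt0r_neq0.
(* The midpoint of [1 / (s - 2)] and [(r - 1) / 2]; by [sE], the hypothesis on [r] says that the
   first is smaller. *)
pose g := (1 / (s - 2) + (r - 1) / 2) / 2.
have g1 : 1 < g * (s - 2).
  by rewrite -ltr_pdivrMr // /g; rewrite sE in sr; lra.
have g2 : 2 * g + 1 < r by rewrite /g; rewrite sE in sr; lra.
have g0 : 0 < g by rewrite -(pmulr_lgt0 _ s20) (lt_trans _ g1).
(* The exponents [g s] and [r] of the upper bound exceed the exponent [2 g + 1] of the lower bound
   [m] by at least [d]. With [b^d = 1 / (6 K)], the upper bound is at most
   [3 K m / (6 K) = m / 2]. *)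
pose d := Num.min (g * s) r - (2 * g + 1).
have d0 : 0 < d by rewrite subr_gt0 lt_min g2 andbT; move: g1; rewrite mulrBr; lra.
pose K : R := 4 `^ s; have K1 : 1 <= K.
  by rewrite -(powRr0 4) ler_powR ?ler1n // ltW // (lt_trans _ s2).
pose b := (6 * K) `^ (- d^-1).
have b0 : 0 < b by rewrite powR_gt0; lra.
have b1 : b <= 1.
  rewrite -[leRHS](powRr0 (6 * K)) ler_powR //; first lra.
  by rewrite oppr_le0 invr_ge0 ltW.
have bd : b `^ d = (6 * K)^-1.
  by rewrite -powRrM mulNr mulVf ?gt_eqF // powR_inv1 //; lra.
pose mu := b `^ g.
have mu0 : 0 < mu by apply: powR_gt0.
have b01 : 0 < b <= 1 by rewrite b0.
have mu1 : mu <= 1 by rewrite -[leRHS](powRr0 b) ger_powR // ltW.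
exists (counterA b), (counterB mu b); split.
- exact: counterA_psd.
- exact: counterB_psd.
apply: (lt_le_trans _ (counter_lower r s2 mu0 b0)).
apply: (le_lt_trans (counter_tr_le r0 s2 mu0 mu1 b0 b1)); rewrite ltcR.
have -> : mu ^+ 2 * b = b `^ (2 * g + 1).
  rewrite powRD; last by rewrite (gt_eqF b0) implybT.
  by rewrite powRr1 ?(ltW b0) // (mulrC 2) powRrM powR_mulrn ?powR_ge0.
set m := b `^ (2 * g + 1); have m0 : 0 < m by apply: powR_gt0.
have le_bd t : Num.min (g * s) r <= t -> b `^ t <= m * (6 * K)^-1.
  move=> ht; rewrite -bd -powRD; last by rewrite (gt_eqF b0) implybT.
  by apply: ger_powR => //; rewrite /d addrC subrK.
have h1 : mu `^ s <= m * (6 * K)^-1.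
  by rewrite -powRrM; apply: le_bd; rewrite ge_min lexx.
have h2 : b `^ r <= m * (6 * K)^-1 by apply: le_bd; rewrite ge_min lexx orbT.
apply: (@le_lt_trans _ _ (K * (3 * (m * (6 * K)^-1)))).
  apply: ler_wpM2l; first exact: powR_ge0.
  rewrite (_ : 3 * _ = 2 * (m * (6 * K)^-1) + m * (6 * K)^-1); last by ring.
  by apply: lerD h2; apply: ler_wpM2l h1.
have cancelK (k : R) : k != 0 -> k * (3 * (m * (6 * k)^-1)) = m / 2.
  by move=> k0; field.
rewrite cancelK; last by rewrite gt_eqF // (lt_le_trans ltr01 K1).
by rewrite ltr_pdivrMr // ltr_pMr // ltr1n.
Qed.

End RealMatrices.

Unset Implicit Arguments.

Theorem theorem3p3 (R : realType) (s r : R) (hs : 1 <= s) (hr : 0 <= r) :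
  ((forall (n : nat) (A B : 'M[R[i]]_n), psdmx A -> psdmx B ->
      log_majorizes
        (mxpow A (r + s) *m mxpow B s)
        (mxpow A r *m mxpow (mxpow A (2^-1) *m B *m mxpow A (2^-1)) s))
   <-> (1 <= s <= 2) \/ (2 < s /\ 0 <= r <= s / (s - 2)))
  /\
  ((forall (n : nat) (A B : 'M[R[i]]_n), psdmx A -> psdmx B ->
      \tr (mxpow A r *m mxpow (mxpow A (2^-1) *m B *m mxpow A (2^-1)) s)
        <= \tr (mxpow A (r + s) *m mxpow B s))
   <-> (1 <= s <= 2) \/ (2 < s /\ 0 <= r <= s / (s - 2))).
Proof.
pose range := (1 <= s <= 2) \/ (2 < s /\ 0 <= r <= s / (s - 2)).
pose log_maj := forall (n : nat) (A B : 'M[R[i]]_n), psdmx A -> psdmx B ->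
  log_majorizes (mxpow A (r + s) *m mxpow B s)
    (mxpow A r *m mxpow (mxpow A (2^-1) *m B *m mxpow A (2^-1)) s).
pose tr_le := forall (n : nat) (A B : 'M[R[i]]_n), psdmx A -> psdmx B ->
  \tr (mxpow A r *m mxpow (mxpow A (2^-1) *m B *m mxpow A (2^-1)) s)
    <= \tr (mxpow A (r + s) *m mxpow B s).
(* Both equivalences follow from the cycle [range], [log_maj], [tr_le], [range] of implications. *)
have range_log_maj : range -> log_maj.
  move=> rg n A B pA pB; rewrite !psdpowE; apply: log_majorizes_psdpow => //.
  case: rg => [/andP[_ s2]|[s2 /andP[_ rs]]]; [by left|right].
  by rewrite -ler_pdivlMr // subr_gt0.
have log_maj_tr : log_maj -> tr_le.
  move=> lm n A B pA pB; apply: log_majorizes_tr (lm n A B pA pB).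
    exact: eigenvalues_psdM_ge0 (mxpow_psd _ _) (mxpow_psd _ _).
  exact: eigenvalues_psdM_ge0 (mxpow_psd _ _) (mxpow_psd _ _).
have tr_range : tr_le -> range.
  move=> tr; have [s2|s2] := leP s 2; first by left; rewrite hs s2.
  right; split=> //; rewrite hr /= leNgt; apply/negP.
  move=> /(tr_counterexample s2)[A [B [pA pB]]].
  have trAB := tr _ A B pA pB; rewrite !psdpowE in trAB.
  by move=> /lt_le_trans/(_ trAB); rewrite ltxx.
split; split.
- by move/log_maj_tr.
- exact: range_log_maj.
- exact: tr_range.
- by move/range_log_maj.
Qed.
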